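(* Let $\mathcal{A} \subseteq \mathcal{B}$ be a unital $C^*$-inclusion. If $p \in \mathcal{A}$ is a full (orthogonal) projection, i.e., $p$ is not contained in any proper ideal of $\mathcal{A}$, then there exists a bijective correspondence between the pseudo-expectations for $\mathcal{A} \subseteq \mathcal{B}$ and the pseudo-expectations for $p\mathcal{A}p \subseteq p\mathcal{B}p$. In particular, $p\mathcal{A}p \subseteq p\mathcal{B}p$ has a unique pseudo-expectation if and only if $\mathcal{A} \subseteq \mathcal{B}$ has a unique pseudo-expectation.
   Context: A (unital) $C^*$-inclusion $\mathcal{A} \subseteq \mathcal{B}$ is an inclusion of unital $C^*$-algebras with $1_{\mathcal{B}} = 1_{\mathcal{A}}$. $I(\mathcal{A})$ denotes the (Hamana) injective envelope of $\mathcal{A}$: the unique minimal injective operator system containing $\mathcal{A}$, which is a $C^*$-algebra containing $\mathcal{A}$ as a $C^*$-subalgebra. A pseudo-expectation for $\mathcal{A} \subseteq \mathcal{B}$ is a unital completely positive map $\Psi: \mathcal{B} \to I(\mathcal{A})$ such that $\Psi(a) = a$ for all $a \in \mathcal{A}$. The corner inclusion $p\mathcal{A}p \subseteq p\mathcal{B}p$ is a unital $C^*$-inclusion with common unit $p$. *)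

(* Defs.v *)
From HB Require Import structures.
From mathcomp Require Import all_boot all_order all_algebra complex.
From mathcomp Require Import all_classical all_reals all_analysis.

Set Implicit Arguments.
Unset Strict Implicit.
Unset Printing Implicit Defensive.

Import Order.TTheory GRing.Theory Num.Theory.
Import numFieldNormedType.Exports.

Local Open Scope classical_set_scope.
Local Open Scope ring_scope.

(* As [algType] is nontrivial (1 != 0), so are the unital C*-algebras here.
   Following [normedModType R[i]], the norm takes its values in R[i].  A type
   cannot inherit both [algType] and [normedModType] (missing join with
   [numDomainType]), so the normed module structure is carried by the alias
   [normed_of A] of A below. *)
HB.mixin Record isPreCStarAlgebra (R : realType) A of GRing.Algebra R[i] A := {
  star : A -> A;
  cnorm : A -> R[i];
  starK : involutive star;
  starD : {morph star : x y / x + y};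
  starZ : forall (c : R[i]) (x : A), star (c *: x) = c^* *: star x;
  starM : forall x y : A, star (x * y) = star y * star x;
  ler_cnormD : forall x y : A, cnorm (x + y) <= cnorm x + cnorm y;
  cnormZ : forall (c : R[i]) (x : A), cnorm (c *: x) = `|c| * cnorm x;
  cnorm0_eq0 : forall x : A, cnorm x = 0 -> x = 0;
  ler_cnormM : forall x y : A, cnorm (x * y) <= cnorm x * cnorm y;
  cnorm_starM : forall x : A, cnorm (star x * x) = cnorm x ^+ 2
}.

#[short(type="preCstarAlgType")]
HB.structure Definition PreCStarAlgebra (R : realType) :=
  {A of GRing.Algebra R[i] A & isPreCStarAlgebra R A}.

Definition normed_of (A : Type) : Type := A.

Section NormedOf.
Variables (R : realType) (A : preCstarAlgType R).

HB.instance Definition _ := GRing.Lmodule.on (normed_of A).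
HB.instance Definition _ := Lmodule_isNormed.Build R[i] (normed_of A)
  (@ler_cnormD R A) (@cnormZ R A) (@cnorm0_eq0 R A).

Lemma normed_ofE (x : A) : `|x : normed_of A| = cnorm x.
Proof. by []. Qed.

End NormedOf.

HB.mixin Record isCStarComplete (R : realType) A of PreCStarAlgebra R A := {
  cauchy_cvg_cnorm : forall F : set_system (normed_of A),
    ProperFilter F -> cauchy F -> cvg F
}.

#[short(type="cstarAlgType")]
HB.structure Definition CStarAlgebra (R : realType) :=
  {A of PreCStarAlgebra R A & isCStarComplete R A}.

HB.instance Definition _ (R : realType) (A : cstarAlgType R) :=
  Uniform_isComplete.Build (normed_of A) (@cauchy_cvg_cnorm R A).

Section CStarInclusion.
Variable R : realType.

(* A unital C*-inclusion, presented as an injective unital *-homomorphism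
   (which is automatically isometric). *)
Record cstar_inclusion (A B : cstarAlgType R) := CStarInclusion {
  cincl :> {lrmorphism A -> B};
  cincl_inj : injective cincl;
  cincl_star : {morph cincl : x / star x}
}.

Definition is_projection (A : cstarAlgType R) (p : A) : Prop :=
  star p = p /\ p * p = p.

(* In a C*-algebra, ideals are two-sided and norm-closed.  Stability under
   scalars is a consequence, as A is unital. *)
Definition closed_ideal (A : cstarAlgType R) (J : set A) : Prop :=
  [/\ closed (J : set (normed_of A)), J 0, (forall x y, J x -> J y -> J (x + y)) &
      forall a x, J x -> J (a * x) /\ J (x * a)].

Definition full (A : cstarAlgType R) (p : A) : Prop :=
  forall J : set A, closed_ideal J -> J p -> J = setT.

Record full_projection (A : cstarAlgType R) := FullProjection {
  fproj : A;
  fproj_is_projection : is_projection fproj;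
  fproj_full : full fproj
}.

Record nz_projection (A : cstarAlgType R) := NzProjection {
  nzproj : A;
  nzproj_is_projection : is_projection nzproj;
  nzproj_neq0 : nzproj != 0
}.

Lemma full_neq0 (A : cstarAlgType R) (p : A) : full p -> p != 0.
Proof.
move=> fp; apply/eqP => p0.
have cJ : closed_ideal [set 0 : A].
  split => //.
  - exact: (@accessible_closed_set1 (normed_of A) (hausdorff_accessible (@norm_hausdorff _ (normed_of A)))).
  - by move=> x y /= -> ->; rewrite addr0.
  - by move=> a x /= ->; rewrite mulr0 mul0r.
have : [set 0 : A] 1 by rewrite (fp _ cJ p0).
by move=> /= /eqP; rewrite oner_eq0.
Qed.

Coercion full_projection_nz (A : cstarAlgType R) (p : full_projection A) :
    nz_projection A :=
  NzProjection (fproj_is_projection p) (full_neq0 (@fproj_full A p)).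

Lemma cincl_projection (A B : cstarAlgType R) (f : cstar_inclusion A B)
  (p : nz_projection A) : is_projection (f (nzproj p)).
Proof.
case: (nzproj_is_projection p) => sp pp.
by split; rewrite -?cincl_star ?sp // -rmorphM pp.
Qed.

Lemma cincl_neq0 (A B : cstarAlgType R) (f : cstar_inclusion A B)
  (p : nz_projection A) : f (nzproj p) != 0.
Proof.
by rewrite -(rmorph0 f) (inj_eq (@cincl_inj _ _ f)) nzproj_neq0.
Qed.

Definition map_projection (A B : cstarAlgType R) (f : cstar_inclusion A B)
    (p : nz_projection A) : nz_projection B :=
  NzProjection (cincl_projection f p) (cincl_neq0 f p).

End CStarInclusion.

Section Corner.
Variables (R : realType) (A : cstarAlgType R) (p : nz_projection A).

Local Notation e := (nzproj p).

(* The corner p A p is the set of x with p x p = x; its unit is p. *)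
Definition in_corner : pred A := fun x => e * x * e == x.

Record corner := Corner {
  corner_val :> A;
  corner_valP : in_corner corner_val
}.

HB.instance Definition _ := [isSub for corner_val].
HB.instance Definition _ := [Choice of corner by <:].

Lemma nzprojK : e * e = e :> A.
Proof. by case: (nzproj_is_projection p). Qed.

Lemma nzproj_star : star e = e.
Proof. by case: (nzproj_is_projection p). Qed.

Lemma cornerE (x : corner) : e * val x * e = val x.
Proof. exact/eqP/corner_valP. Qed.

Lemma corner_mull (x : corner) : e * val x = val x.
Proof. by rewrite -cornerE !mulrA nzprojK. Qed.

Lemma corner_mulr (x : corner) : val x * e = val x.
Proof. by rewrite -cornerE -!mulrA nzprojK. Qed.

Lemma in_corner_submod : submod_closed in_corner.
Proof.
split; first by rewrite /in_corner unfold_in mulr0 mul0r.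
move=> a x y; rewrite !unfold_in => /eqP hx /eqP hy; apply/eqP.
by rewrite mulrDr mulrDl -scalerAr -scalerAl hx hy.
Qed.

HB.instance Definition _ :=
  GRing.SubChoice_isSubLmodule.Build R[i] A in_corner corner in_corner_submod.

Lemma corner1_subproof : e * e * e == e :> A.
Proof. by rewrite !nzprojK. Qed.

Lemma cornerM_subproof (x y : corner) :
  e * (val x * val y) * e == val x * val y.
Proof. by rewrite mulrA corner_mull -mulrA corner_mulr. Qed.

Lemma corner_star_subproof (x : corner) :
  e * star (val x) * e == star (val x).
Proof. by rewrite -{2}cornerE !starM nzproj_star mulrA. Qed.

Definition corner1 : corner := Corner corner1_subproof.
Definition cornerM (x y : corner) : corner := Corner (cornerM_subproof x y).
Definition corner_star (x : corner) : corner := Corner (corner_star_subproof x).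

Lemma cornerMA : associative cornerM.
Proof. by move=> x y z; apply: val_inj; rewrite /= mulrA. Qed.
Lemma corner_mul1 : left_id corner1 cornerM.
Proof. by move=> x; apply: val_inj; rewrite /= corner_mull. Qed.
Lemma corner_mulr1 : right_id corner1 cornerM.
Proof. by move=> x; apply: val_inj; rewrite /= corner_mulr. Qed.
Lemma cornerDl : left_distributive cornerM +%R.
Proof. by move=> x y z; apply: val_inj; rewrite /= mulrDl. Qed.
Lemma cornerDr : right_distributive cornerM +%R.
Proof. by move=> x y z; apply: val_inj; rewrite /= mulrDr. Qed.
Lemma corner1_neq0 : corner1 != 0.
Proof. by rewrite -val_eqE /= nzproj_neq0. Qed.

HB.instance Definition _ := GRing.Zmodule_isNzRing.Build corner
  cornerMA corner_mul1 corner_mulr1 cornerDl cornerDr corner1_neq0.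

Lemma corner_scaleAl (c : R[i]) (x y : corner) : c *: (x * y) = c *: x * y.
Proof. by apply: val_inj; rewrite /= scalerAl. Qed.
Lemma corner_scaleAr (c : R[i]) (x y : corner) : c *: (x * y) = x * (c *: y).
Proof. by apply: val_inj; rewrite /= scalerAr. Qed.

HB.instance Definition _ :=
  GRing.Lmodule_isLalgebra.Build R[i] corner corner_scaleAl.
HB.instance Definition _ :=
  GRing.Lalgebra_isAlgebra.Build R[i] corner corner_scaleAr.

Definition corner_norm (x : corner) : R[i] := cnorm (val x).

Lemma corner_starK : involutive corner_star.
Proof. by move=> x; apply: val_inj; rewrite /= starK. Qed.
Lemma corner_starD : {morph corner_star : x y / x + y}.
Proof. by move=> x y; apply: val_inj; rewrite /= starD. Qed.
Lemma corner_starZ (c : R[i]) (x : corner) :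
  corner_star (c *: x) = c^* *: corner_star x.
Proof. by apply: val_inj; rewrite /= starZ. Qed.
Lemma corner_starM (x y : corner) :
  corner_star (x * y) = corner_star y * corner_star x.
Proof. by apply: val_inj; rewrite /= starM. Qed.
Lemma corner_ler_normD (x y : corner) :
  corner_norm (x + y) <= corner_norm x + corner_norm y.
Proof. exact: ler_cnormD. Qed.
Lemma corner_normZ (c : R[i]) (x : corner) :
  corner_norm (c *: x) = `|c| * corner_norm x.
Proof. exact: cnormZ. Qed.
Lemma corner_norm0_eq0 (x : corner) : corner_norm x = 0 -> x = 0.
Proof. by move/cnorm0_eq0 => x0; apply: val_inj. Qed.
Lemma corner_ler_normM (x y : corner) :
  corner_norm (x * y) <= corner_norm x * corner_norm y.
Proof. exact: ler_cnormM. Qed.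
Lemma corner_norm_starM (x : corner) :
  corner_norm (corner_star x * x) = corner_norm x ^+ 2.
Proof. exact: cnorm_starM. Qed.

HB.instance Definition _ := isPreCStarAlgebra.Build R corner
  corner_starK corner_starD corner_starZ corner_starM corner_ler_normD
  corner_normZ corner_norm0_eq0 corner_ler_normM corner_norm_starM.

Lemma corner_cauchy_cvg (F : set_system (normed_of corner)) :
  ProperFilter F -> cauchy F -> cvg F.
Proof.
move=> FF cF.
pose v := corner_val : normed_of corner -> normed_of A.
have vE (x y : normed_of corner) : `|v x - v y| = `|x - y| by [].
have cG : cauchy (v @ F).
  apply/cauchyP => d d0.
  have /cauchyP/(_ _ d0)[x Fx] := cF.
  exists (v x); rewrite /nbhs /=; apply: filterS Fx => y.
  by rewrite -!ball_normE /= vE.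
have cvG : cvg (v @ F) by exact: (@cauchy_cvg_cnorm R A _ _ cG).
have /cvg_ex[l /= Fl] := cvG.
have lP : e * l * e == l.
  pose c : R[i] := cnorm e * cnorm e + 1.
  have p0 : 0 <= cnorm e by exact: (@normr_ge0 _ (normed_of A)).
  have c0 : 0 < c by rewrite ltr_pwDr // mulr_ge0.
  rewrite -subr_eq0; apply/eqP/cnorm0_eq0/le_anti.
  rewrite [X in _ && X](@normr_ge0 _ (normed_of A)) andbT.
  apply/ler_addgt0Pr => d d0; rewrite add0r.
  have /cvgrPdist_lt/(_ _ (divr_gt0 d0 c0)) := Fl.
  rewrite near_simpl => /filter_ex[x] lx.
  have -> : e * l * e - l = e * (l - val x) * e + (-1) *: (l - val x) :> A.
    rewrite mulrBr mulrBl cornerE scaleN1r opprB.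
    by rewrite addrA subrK.
  apply: le_trans (ler_cnormD _ _) _; rewrite cnormZ normrN1 mul1r.
  apply: (@le_trans _ _ (c * cnorm (l - val x))).
    rewrite mulrDl mul1r lerD2r.
    apply: le_trans (ler_cnormM _ _) _.
    rewrite mulrAC ler_wpM2r //.
    by apply: le_trans (ler_cnormM _ _) _.
  by rewrite mulrC -ler_pdivlMr // ltW.
apply/cvg_ex; exists (Corner lP).
apply/cvgrPdist_lt => d d0.
have /cvgrPdist_lt/(_ d d0) := Fl.
by rewrite !near_simpl; apply: filterS.
Qed.

HB.instance Definition _ := isCStarComplete.Build R corner corner_cauchy_cvg.

End Corner.

Section CornerInclusion.
Variables (R : realType) (A B : cstarAlgType R) (f : cstar_inclusion A B).
Variable (p : nz_projection A).

Local Notation q := (map_projection f p).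

Lemma corner_map_subproof (x : corner p) : nzproj q * f (val x) * nzproj q == f (val x).
Proof. by rewrite /= -!rmorphM cornerE. Qed.

Definition corner_map (x : corner p) : corner q :=
  Corner (corner_map_subproof x).

Lemma corner_map_is_zmod_morphism : zmod_morphism corner_map.
Proof. by move=> x y; apply: val_inj; rewrite /= rmorphB. Qed.
Lemma corner_map_is_monoid_morphism : monoid_morphism corner_map.
Proof. by split=> [|x y]; apply: val_inj; rewrite //= rmorphM. Qed.
Lemma corner_map_is_scalable : scalable corner_map.
Proof. by move=> c x; apply: val_inj; rewrite /= linearZ. Qed.

HB.instance Definition _ := GRing.isZmodMorphism.Build _ _ corner_map
  corner_map_is_zmod_morphism.
HB.instance Definition _ := GRing.isMonoidMorphism.Build _ _ corner_map
  corner_map_is_monoid_morphism.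
HB.instance Definition _ := GRing.isScalable.Build _ _ _ _ corner_map
  corner_map_is_scalable.

Lemma corner_map_inj : injective corner_map.
Proof. by move=> x y /(congr1 val) /= /cincl_inj; apply: val_inj. Qed.
Lemma corner_map_star : {morph corner_map : x / star x}.
Proof. by move=> x; apply: val_inj; rewrite /= cincl_star. Qed.

Definition corner_inclusion : cstar_inclusion (corner p) (corner q) :=
  CStarInclusion corner_map_inj corner_map_star.

End CornerInclusion.

Section InjectiveEnvelope.
Variable R : realType.
Implicit Types A B C D I : cstarAlgType R.

Definition mxstar C m n (X : 'M[C]_(m, n)) : 'M[C]_(n, m) :=
  \matrix_(i, j) star (X j i).

(* Positive elements of the C*-algebra M_n(C) are the Y^* Y. *)
Definition mx_positive C n (X : 'M[C]_n) : Prop :=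
  exists Y : 'M[C]_n, X = mxstar Y *m Y.

Definition operator_system C (S : set C) : Prop :=
  [/\ S 1, (forall (c : R[i]) x y, S x -> S y -> S (c *: x + y)) &
      forall x, S x -> S (star x)].

(* Unital completely positive maps from the operator system S in C to the
   operator system E in D; values outside S are irrelevant.  The order on
   M_n(S) is the one inherited from M_n(C). *)
Definition ucp_on C D (S : set C) (E : set D) (f : C -> D) : Prop :=
  [/\ (forall x, S x -> E (f x)),
      (forall (c : R[i]) x y, S x -> S y -> f (c *: x + y) = c *: f x + f y),
      f 1 = 1 &
      forall n (X : 'M[C]_n), (forall i j, S (X i j)) ->
        mx_positive X -> mx_positive (map_mx f X)].

Definition ucp C D (f : C -> D) : Prop := ucp_on setT setT f.

Definition injective_system D (E : set D) : Prop :=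
  operator_system E /\
  forall C (S T : set C) (f : C -> D),
    operator_system S -> operator_system T -> S `<=` T -> ucp_on S E f ->
    exists2 g : C -> D, ucp_on T E g & forall x, S x -> g x = f x.

(* k presents the C*-algebra I as the injective envelope of A: I is injective
   and minimal among the injective operator systems containing k(A). *)
Definition injective_envelope A I (k : cstar_inclusion A I) : Prop :=
  injective_system [set: I] /\
  forall E : set I, injective_system E -> (forall a, E (k a)) -> E = setT.

Definition pseudo_expectation A B I (f : cstar_inclusion A B)
    (k : cstar_inclusion A I) (Psi : B -> I) : Prop :=
  ucp Psi /\ forall a, Psi (f a) = k a.

End InjectiveEnvelope.

(* Main.v *)
(* By fullness, 1 = sum_i a_i^* p a_i for finitely many a_i in A.  Identify p I(A) p
   with the injective envelope of pAp.  A pseudo-expectation Psi restricts to the ucp map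
   Psi : pBp -> p I(A) p, and conversely Phi : pBp -> p I(A) p extends to
     b |-> sum_(i, j) a_i^* Phi(p a_i b a_j^* p) a_j;
   these operations are mutually inverse because pseudo-expectations are bimodule maps.
   For the identification, injectivity provides ucp maps theta : p I(A) p -> I(pAp) and
   theta' : I(pAp) -> p I(A) p over pAp.  theta theta' = 1 by rigidity of I(pAp);
   theta' theta = 1 since, by the same extension formula with B = I(A), rigidity of I(A)
   passes to its corner.  Rigidity is derived from minimality by Hamana's argument: a
   minimal element among the ucp maps fixing A is idempotent, and its range is injective.
   No spectral theory is needed: x is positive when it is selfadjoint and |t - x| <= t for
   some t, and square roots come from an explicit iteration. *)
Require Import Defs.
From HB Require Import structures.
From mathcomp Require Import all_boot all_order all_algebra complex.
From mathcomp Require Import all_classical all_reals all_analysis.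
From mathcomp Require Import lra ring.
From Stdlib Require Ncring Ncring_tac.

Set Implicit Arguments.
Unset Strict Implicit.
Unset Printing Implicit Defensive.

Import Order.TTheory GRing.Theory Num.Theory.
Import numFieldNormedType.Exports.

Local Open Scope classical_set_scope.
Local Open Scope complex_scope.
Local Open Scope ring_scope.

(** * Norms and limits *)

(** As ideals are closed, fullness only puts finite sums of terms [x p y] near 1: such a sum has to
    be inverted and then made symmetric. Hamana's argument usually takes lower bounds of chains from
    weak-* compactness of maps into B(H). Here injectivity of I(A) does this work: it extends the
    eventual value of nets to a ucp map on all bounded nets, a generalised limit along the chain.
    Complete positivity is stated with Gram matrices [Y^* Y]. That sums of these have the same form,
    and that injective *-homomorphisms reflect them, is obtained from M_n(C) being a C*-algebra in
    which the [x^* x] form a cone. Hence the operator norm on the Hilbert module C^n, and a theory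
    of the positive cone that starts from the axioms of the norm. *)

Section NoncommutativeRing.
Variable S : nzRingType.

(** Identities in a C*-algebra are beyond [ring], which requires commutativity; these instances open
    them to noncommutative normalisation. *)
#[local] Instance nzRing_ops :
  @Ncring.Ring_ops S 0 1 +%R *%R (fun x y => x - y) -%R eq := {}.

#[local] Instance nzRing_ring : Ncring.Ring (Ro := nzRing_ops).
Proof.
split; try exact _.
- exact: add0r.
- exact: addrC.
- exact: addrA.
- exact: mul1r.
- exact: mulr1.
- exact: mulrA.
- exact: mulrDl.
- by move=> x y z; exact: mulrDr.
- by [].
- exact: subrr.
Qed.

End NoncommutativeRing.
#[global] Existing Instance nzRing_ops.
#[global] Existing Instance nzRing_ring.

Ltac ncring := Ncring_tac.non_commutative_ring.

(** Balls of [normed_of A] have radii in [R[i]], where the order makes a positive radius real;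
    estimates can thus be carried out in [R]. *)
Lemma gt0_complexP (R : realType) (e : R[i]) :
  0 < e -> exists2 e' : R, 0 < e' & e = e'%:C.
Proof.
case: e => a b; rewrite ltcE /= => /andP[/eqP-> a0].
by exists a.
Qed.

Section RealNorm.
Variables (R : realType) (A : cstarAlgType R).
Implicit Types (x y z a b : A) (r s t : R).

Definition nrm x : R := complex.Re (cnorm x).

Lemma cnormE x : cnorm x = (nrm x)%:C.
Proof.
have /ger0_Im : 0 <= cnorm x by exact: (@normr_ge0 _ (normed_of A)).
by rewrite /nrm; case: (cnorm x) => u v /= ->.
Qed.

Lemma nrm_ge0 x : 0 <= nrm x.
Proof.
rewrite -(lecR 0 (nrm x)) -cnormE.
exact: (@normr_ge0 _ (normed_of A)).
Qed.

Lemma nrmD x y : nrm (x + y) <= nrm x + nrm y.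
Proof. by have := ler_cnormD x y; rewrite !cnormE -rmorphD lecR. Qed.

Lemma nrmM x y : nrm (x * y) <= nrm x * nrm y.
Proof. by have := ler_cnormM x y; rewrite !cnormE -rmorphM lecR. Qed.

Lemma nrmZ (c : R[i]) x : nrm (c *: x) = Normc.normc c * nrm x.
Proof.
have := cnormZ c x; rewrite !cnormE normc_def => h.
apply: (@complexI R); rewrite h rmorphM /=; case: c {h} => a b. rewrite /Normc.normc /=. reflexivity.
Qed.

Lemma nrmZr r x : nrm (r%:C *: x) = `|r| * nrm x.
Proof. by rewrite nrmZ /= expr0n addr0 sqrtr_sqr. Qed.

Lemma nrmN x : nrm (- x) = nrm x.
Proof. by have := nrmZr (-1) x; rewrite rmorphN rmorph1 scaleN1r normrN1 mul1r. Qed.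

Lemma nrmB x y : nrm (x - y) <= nrm x + nrm y.
Proof. by rewrite -(nrmN y) nrmD. Qed.

Lemma nrmBC x y : nrm (x - y) = nrm (y - x).
Proof. by rewrite -nrmN opprB. Qed.

Lemma nrm0 : nrm 0 = 0.
Proof. by have := nrmZr 0 0; rewrite rmorph0 scale0r normr0 mul0r. Qed.

Lemma nrm0_eq0 x : nrm x = 0 -> x = 0.
Proof. by move=> h; apply: cnorm0_eq0; rewrite cnormE h. Qed.

Lemma nrm_starM x : nrm (star x * x) = nrm x ^+ 2.
Proof. by apply: (@complexI R); rewrite -cnormE cnorm_starM cnormE rmorphXn. Qed.

Lemma star0 : star 0 = 0 :> A.
Proof. by have := starZ 0 (0 : A); rewrite rmorph0 !scale0r. Qed.

Lemma starN x : star (- x) = - star x.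
Proof. by rewrite -scaleN1r starZ rmorphN rmorph1 scaleN1r. Qed.

Lemma starB x y : star (x - y) = star x - star y.
Proof. by rewrite starD starN. Qed.

Lemma star1 : star 1 = 1 :> A.
Proof. by rewrite -[LHS]mulr1 -[X in _ * X]starK -starM mulr1 starK. Qed.

Lemma star_sum (I : Type) (s : seq I) (P : pred I) (F : I -> A) :
  star (\sum_(i <- s | P i) F i) = \sum_(i <- s | P i) star (F i).
Proof. exact: (big_morph _ starD star0). Qed.

Lemma nrm_star x : nrm (star x) = nrm x.
Proof.
wlog suff: x / nrm x <= nrm (star x).
  by move=> h; apply/le_anti; rewrite h -{2}(starK x) h.
have [/eqP ->|x0] := boolP (nrm x == 0); first exact: nrm_ge0.
have xp : 0 < nrm x by rewrite lt_def x0 nrm_ge0.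
by rewrite -(ler_pM2r xp) -expr2 -nrm_starM nrmM.
Qed.

Lemma nrm1 : nrm (1 : A) = 1.
Proof.
have h := nrm_starM 1; rewrite star1 mulr1 expr2 in h.
have n0 : nrm (1 : A) != 0.
  by apply/eqP => /nrm0_eq0/eqP; rewrite oner_eq0.
by apply: (mulfI n0); rewrite -h mulr1.
Qed.

Lemma starZr r x : star (r%:C *: x) = r%:C *: star x.
Proof. by rewrite starZ [_^*]conjc_real. Qed.

Lemma nrm_sa_sqr x : star x = x -> nrm (x * x) = nrm x ^+ 2.
Proof. by move=> h; rewrite -nrm_starM h. Qed.

Lemma nrm_sum (I : Type) (s : seq I) (P : pred I) (F : I -> A) :
  nrm (\sum_(i <- s | P i) F i) <= \sum_(i <- s | P i) nrm (F i).
Proof.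
elim/big_rec2: _ => [|i u v _ h]; first by rewrite nrm0.
by apply: le_trans (nrmD _ _) _; rewrite lerD2l.
Qed.

(** Real scalars as elements of the algebra, so that [ncring] can handle them as ring elements. *)
Definition rsc r : A := r%:C%:A.

Lemma rscM r x : rsc r * x = r%:C *: x.
Proof. by rewrite -scalerAl mul1r. Qed.

Lemma rscMr r x : x * rsc r = r%:C *: x.
Proof. by rewrite -scalerAr mulr1. Qed.

Lemma rsc_comm r x : x * rsc r = rsc r * x.
Proof. by rewrite rscM rscMr. Qed.

Lemma rscD r s : rsc (r + s) = rsc r + rsc s.
Proof. by rewrite /rsc rmorphD scalerDl. Qed.

Lemma rscN r : rsc (- r) = - rsc r.
Proof. by rewrite /rsc rmorphN scaleNr. Qed.

Lemma rscB r s : rsc (r - s) = rsc r - rsc s.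
Proof. by rewrite rscD rscN. Qed.

Lemma rsc_mul r s : rsc (r * s) = rsc r * rsc s.
Proof. by rewrite rscM scalerA -rmorphM. Qed.

Lemma rsc1 : rsc 1 = 1.
Proof. by rewrite /rsc rmorph1 scale1r. Qed.

Lemma rsc0 : rsc 0 = 0.
Proof. by rewrite /rsc rmorph0 scale0r. Qed.

Lemma star_rsc r : star (rsc r) = rsc r.
Proof. by rewrite starZr star1. Qed.

Lemma nrm_rsc r : nrm (rsc r) = `|r|.
Proof. by rewrite nrmZr nrm1 mulr1. Qed.

Lemma nrm_eq0_small x : (forall e, 0 < e -> nrm x <= e) -> x = 0.
Proof.
move=> h; apply: nrm0_eq0; apply/le_anti; rewrite nrm_ge0 andbT.
by apply/ler_addgt0Pr => e e0; rewrite add0r h.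
Qed.

End RealNorm.

Section Limits.
Variables (R : realType) (A : cstarAlgType R).
Implicit Types (x y z a b : A) (u v : nat -> A).

Definition limto u x :=
  forall e : R, 0 < e -> exists N, forall n, (N <= n)%N -> nrm (u n - x) < e.

Lemma limto_unique u x y : limto u x -> limto u y -> x = y.
Proof.
move=> ux uy; apply/eqP; rewrite -subr_eq0; apply/eqP/nrm_eq0_small => e e0.
have e20 : 0 < e / 2 by rewrite divr_gt0.
have [[N hN] [M hM]] := (ux _ e20, uy _ e20).
have -> : x - y = (u (maxn N M) - y) - (u (maxn N M) - x) by ncring.
apply: le_trans (nrmB _ _) _.
have := hN _ (leq_maxl N M); have := hM _ (leq_maxr N M); lra.
Qed.

Lemma limto_cst x : limto (fun=> x) x.
Proof. by move=> e e0; exists 0%N => n _; rewrite subrr nrm0. Qed.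

Lemma limto_shift u x : limto u x -> limto (fun n => u n.+1) x.
Proof. by move=> h e /h[N hN]; exists N => n Nn; rewrite hN // leqW. Qed.

Lemma limtoD u v x y : limto u x -> limto v y -> limto (fun n => u n + v n) (x + y).
Proof.
move=> ux vy e e0.
have e20 : 0 < e / 2 by rewrite divr_gt0.
have [[N hN] [M hM]] := (ux _ e20, vy _ e20).
exists (maxn N M) => n; rewrite geq_max => /andP[/hN ? /hM ?].
have -> : u n + v n - (x + y) = (u n - x) + (v n - y) by ncring.
by apply: le_lt_trans (nrmD _ _) _; lra.
Qed.

Lemma limtoM u v x y : limto u x -> limto v y -> limto (fun n => u n * v n) (x * y).
Proof.
move=> ux vy e e0.
pose K := nrm x + nrm y + 1.
have K0 : 0 < K by have := (nrm_ge0 x, nrm_ge0 y); rewrite /K => -[? ?]; lra.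
pose d := Num.min 1 (e / (2 * K)).
have d0 : 0 < d by rewrite lt_min ltr01 divr_gt0 // mulr_gt0.
have [[N hN] [M hM]] := (ux _ d0, vy _ d0).
exists (maxn N M) => n; rewrite geq_max => /andP[/hN h1 /hM h2].
have -> : u n * v n - x * y = (u n - x) * (v n - y) + ((u n - x) * y + x * (v n - y)).
  by ncring.
have d1 : d <= 1 by rewrite ge_min lexx.
have dK : d * K <= e / 2.
  apply: (@le_trans _ _ (e / (2 * K) * K)).
    by rewrite ler_pM2r // ge_min lexx orbT.
  by rewrite invfM mulrA mulfVK // gt_eqF.
have h3 : nrm ((u n - x) * (v n - y)) <= d.
  apply: le_trans (nrmM _ _) _; rewrite -[d]mulr1.
  by apply: ler_pM; rewrite ?nrm_ge0 ?ltW //; apply: lt_le_trans d1.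
have h4 : nrm ((u n - x) * y) <= d * nrm y.
  by apply: le_trans (nrmM _ _) _; rewrite ler_wpM2r ?nrm_ge0 // ltW.
have h5 : nrm (x * (v n - y)) <= d * nrm x.
  by apply: le_trans (nrmM _ _) _; rewrite mulrC ler_wpM2r ?nrm_ge0 // ltW.
apply: le_lt_trans (nrmD _ _) _.
have := nrmD ((u n - x) * y) (x * (v n - y)).
rewrite /K in dK; rewrite !mulrDr mulr1 in dK; lra.
Qed.

Lemma limto_star u x : limto u x -> limto (fun n => star (u n)) (star x).
Proof. by move=> h e /h[N hN]; exists N => n Nn; rewrite -starB nrm_star hN. Qed.

Lemma limto_eq u v x : u =1 v -> limto u x -> limto v x.
Proof. by move=> uv h e /h[N hN]; exists N => n /hN; rewrite uv. Qed.

Lemma limto_nrm_le u x (r : R) : (forall n, nrm (u n) <= r) -> limto u x -> nrm x <= r.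
Proof.
move=> h ux; apply/ler_addgt0Pr => e /ux[N /(_ N (leqnn N)) hN].
have -> : x = u N - (u N - x) by ncring.
by apply: le_trans (nrmB _ _) _; have := h N; lra.
Qed.

(** Comparison test: the increments of [s] bound norms, so [s] increases to its supremum and its
    tails bound those of [u]. It serves both the square root and the Neumann series. *)
Lemma dominated_limto u (s : nat -> R) (M : R) :
  (forall n, s n <= M) -> (forall n, nrm (u n.+1 - u n) <= s n.+1 - s n) ->
  exists x, limto u x.
Proof.
move=> sM us.
have hk n k : nrm (u (n + k)%N - u n) <= s (n + k)%N - s n.
  elim: k => [|k IH]; first by rewrite addn0 !subrr nrm0.
  have -> : u (n + k.+1)%N - u n = (u (n + k).+1 - u (n + k)%N) + (u (n + k)%N - u n).
    by rewrite addnS; ncring.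
  apply: le_trans (nrmD _ _) _.
  by have := us (n + k)%N; rewrite addnS; lra.
pose E := range s.
have hE : has_sup E by split; [exists (s 0%N), 0%N | exists M => _ [n _ <-]].
have close (e : R) : 0 < e -> exists N, forall n, (N <= n)%N -> nrm (u n - u N) < e.
  move=> e0; have [_ [N _ <-] hN] := sup_adherent e0 hE.
  exists N => n Nn; rewrite -(subnKC Nn).
  apply: le_lt_trans (hk _ _) _.
  have : s (N + (n - N))%N <= sup E by apply: sup_upper_bound => //; exists (N + (n - N))%N.
  lra.
pose v : nat -> normed_of A := u.
have cF : cauchy (v @ \oo).
  apply: cauchy_exP => _ /gt0_complexP[e' e'0 ->].
  have [N hN] := close _ e'0.
  exists (v N); exists N => // n /= /hN.
  by rewrite -ball_normE /= normed_ofE cnormE ltcR nrmBC.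
have cvF : cvg (v @ \oo) by exact: (@cauchy_cvg_cnorm R A _ _ cF).
have /cvg_ex[x /= hx] := cvF.
exists x => e e0.
have e0C : 0 < e%:C :> R[i] by rewrite ltcR.
have /cvgrPdist_lt/(_ _ e0C)[N _ hN] := hx.
by exists N => n /hN /=; rewrite normed_ofE cnormE ltcR nrmBC.
Qed.

End Limits.

(** * The positive cone *)

Section Positivity.
Variables (R : realType) (A : cstarAlgType R).
Implicit Types (x y z a b c d v : A) (r s t : R).

Local Notation sa x := (star x = x).

Lemma commrZ (k : R[i]) x y : GRing.comm x y -> GRing.comm x (k *: y).
Proof. by rewrite /GRing.comm -scalerAr -scalerAl => ->. Qed.

Lemma limto_comm z (u : nat -> A) y :
  (forall n, GRing.comm z (u n)) -> limto u y -> GRing.comm z y.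
Proof.
move=> zu uy; apply: (@limto_unique _ _ (fun n => z * u n)).
  exact: limtoM (limto_cst z) uy.
apply: (@limto_eq _ _ (fun n => u n * z)) => [n|]; first by rewrite zu.
exact: limtoM uy (limto_cst z).
Qed.

Definition half x : A := (2^-1)%:C *: x.

Lemma halfD x : half x + half x = x.
Proof.
rewrite /half -scalerDl -rmorphD.
have -> : 2^-1 + 2^-1 = 1 :> R by lra.
by rewrite rmorph1 scale1r.
Qed.

(* The solution [1 - y] of [(1 - y)^2 = 1 - x] is the limit of the iteration
   [y' = (x + y^2) / 2]; as [nrm x <= 1], its increments are dominated by those of
   the scalar iteration [s' = (1 + s^2) / 2], which increases to 1. *)
Lemma sqrt_iteration x : nrm x <= 1 ->
  exists y, [/\ nrm y <= 1, y + y = x + y * y, sa x -> sa y &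
    forall z, GRing.comm z x -> GRing.comm z y].
Proof.
move=> x1.
pose u n := iter n (fun w => half (x + w * w)) (0 : A).
pose s n := iter n (fun w : R => (1 + w * w) / 2) 0.
have uS n : u n.+1 = half (x + u n * u n) by [].
have sS n : s n.+1 = (1 + s n * s n) / 2 by [].
have uc z n : GRing.comm z x -> GRing.comm z (u n).
  move=> zx; elim: n => [|n IH]; first exact: commr0.
  by rewrite uS; apply/commrZ/commrD => //; apply: commrM.
have xu n : GRing.comm x (u n) by exact: uc.
have uu m n : GRing.comm (u m) (u n) by apply/uc/commr_sym.
have s01 n : 0 <= s n <= 1.
  elim: n => [|n /andP[h1 h2]]; first by rewrite /s /= lexx ler01.
  rewrite sS; have h3 : s n * s n <= 1 by nra.
  by have := mulr_ge0 h1 h1; lra.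
have us n : nrm (u n) <= s n.
  elim: n => [|n IH]; first by rewrite /u /= nrm0.
  rewrite uS sS nrmZr ger0_norm ?invr_ge0 // mulrC ler_pM2r ?invr_gt0 //.
  apply: le_trans (nrmD _ _) _; apply: lerD => //.
  by apply: le_trans (nrmM _ _) _; apply: ler_pM; rewrite ?nrm_ge0.
have uds n : nrm (u n.+1 - u n) <= s n.+1 - s n.
  elim: n => [|n IH].
    rewrite /u /s /= mulr0 addr0 !subr0 !mul0r addr0 nrmZr ger0_norm ?invr_ge0 //.
    by rewrite div1r ger_pMr ?invr_gt0.
  (* The iterates commute, so this difference of squares factors. *)
  have -> : u n.+2 - u n.+1 = half ((u n.+1 - u n) * (u n.+1 + u n)).
    transitivity (half (x + u n.+1 * u n.+1) - half (x + u n * u n)); first by [].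
    rewrite /half -scalerBr; congr (_ *: _).
    have h := uu n n.+1; rewrite mulrBl !mulrDr h; ncring.
  have -> : s n.+2 - s n.+1 = 2^-1 * ((s n.+1 - s n) * (s n.+1 + s n)).
    by rewrite (sS n.+1) [in X in _ - X]sS; field.
  rewrite nrmZr ger0_norm ?invr_ge0 // ler_pM2l ?invr_gt0 //.
  apply: le_trans (nrmM _ _) _; apply: ler_pM; rewrite ?nrm_ge0 //.
  by apply: le_trans (nrmD _ _) _; apply: lerD; apply: us.
have s1 n : s n <= 1 by have /andP[] := s01 n.
have [y uy] := dominated_limto s1 uds.
exists y; split.
- by apply: limto_nrm_le uy => n; apply: le_trans (us n) _.
- apply: (@limto_unique _ _ (fun n => u n.+1 + u n.+1)).
    by apply: limtoD; apply: limto_shift.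
  apply: (@limto_eq _ _ (fun n => x + u n * u n)) => [n|].
    by rewrite uS halfD.
  by apply: limtoD; [exact: limto_cst | exact: limtoM].
- move=> xs; apply: limto_unique (uy).
  apply: (@limto_eq _ _ (fun n => star (u n))); last exact: (limto_star uy).
  elim=> [|n IH]; first by rewrite /u /= star0.
  by rewrite uS starZr starD starM IH xs.
- by move=> z zx; apply: limto_comm uy => n; exact: uc.
Qed.

(* For selfadjoint [a], having [nrm (t - a) <= t] for some [t] means that the
   spectrum of [a] is nonnegative. *)
Definition pos a := sa a /\ exists2 t : R, 0 <= t & nrm (rsc A t - a) <= t.

Lemma pos_sa a : pos a -> sa a. Proof. by case. Qed.

Lemma pos_rsc t : 0 <= t -> pos (rsc A t).
Proof. by move=> t0; split; [rewrite star_rsc | exists t => //; rewrite subrr nrm0]. Qed.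

Lemma pos0 : pos 0. Proof. by rewrite -(rsc0 A); apply: pos_rsc. Qed.

Lemma posD a b : pos a -> pos b -> pos (a + b).
Proof.
move=> [sa_a [t t0 ta]] [sb [s s0 sb']]; split; first by rewrite starD sa_a sb.
exists (t + s); first exact: addr_ge0.
have -> : rsc A (t + s) - (a + b) = (rsc A t - a) + (rsc A s - b).
  by rewrite rscD; ncring.
exact: le_trans (nrmD _ _) (lerD ta sb').
Qed.

Lemma posZ r a : 0 <= r -> pos a -> pos (r%:C *: a).
Proof.
move=> r0 [sa_a [t t0 ta]]; split; first by rewrite starZr sa_a.
exists (r * t); first exact: mulr_ge0.
by rewrite rsc_mul rscM -scalerBr nrmZr ger0_norm // ler_wpM2l.
Qed.

Lemma posZK r a : 0 < r -> pos (r%:C *: a) -> pos a.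
Proof.
move=> r0 /(posZ (ltW _ : 0 <= r^-1)).
rewrite scalerA -rmorphM mulVf ?gt_eqF // rmorph1 scale1r; apply.
by rewrite invr_gt0.
Qed.

Lemma pos_double a : pos (a + a) -> pos a.
Proof.
move=> h; apply: (@posZK 2) => //.
by rewrite rmorphD rmorph1 scalerDl scale1r.
Qed.

Lemma pos_sum (I : Type) (s : seq I) (P : pred I) (F : I -> A) :
  (forall i, P i -> pos (F i)) -> pos (\sum_(i <- s | P i) F i).
Proof. by move=> h; elim/big_ind: _ => //; [exact: pos0 | exact: posD]. Qed.

(** Dividing by [t] turns [a] into [1 - x] with [nrm x <= 1], whose root is [1 - y]; if [t = 0],
    then [a = 0]. The clause on commutation stands in for functional calculus: roots of commuting
    elements commute. *)
Lemma pos_sqrt a : pos a ->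
  exists b, [/\ pos b, b * b = a & forall z, GRing.comm z a -> GRing.comm z b].
Proof.
move=> [sa_a [t t0 ta]].
have [t00|tn0] := eqVneq t 0.
  exists 0; split; [exact: pos0 | | by move=> z _; exact: commr0].
  rewrite mulr0; apply/esym/nrm0_eq0/le_anti; rewrite nrm_ge0 andbT.
  by move: ta; rewrite t00 rsc0 sub0r nrmN.
have tp : 0 < t by rewrite lt_def tn0.
pose x := 1 - (t^-1)%:C *: a.
have xE : (t^-1)%:C *: (rsc A t - a) = x.
  by rewrite scalerBr -rscM -rsc_mul mulVf // rsc1.
have x1 : nrm x <= 1.
  rewrite -xE nrmZr ger0_norm ?invr_ge0 //.
  by rewrite mulrC ler_pdivrMr // mul1r.
have [y [y1 yE ys yc]] := sqrt_iteration x1.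
have sx : sa x by rewrite starB star1 starZr sa_a.
pose q := Num.sqrt t.
have q0 : 0 <= q by exact: sqrtr_ge0.
exists (q%:C *: (1 - y)); split.
- split; first by rewrite starZr starB star1 ys.
  exists q => //.
  have -> : rsc A q - q%:C *: (1 - y) = q%:C *: y.
    by rewrite scalerBr opprB addrC -addrA -/(rsc A q) addNr addr0.
  by rewrite nrmZr ger0_norm // ler_piMr.
- rewrite -scalerAl -scalerAr scalerA -rmorphM -expr2 sqr_sqrtr //.
  have -> : (1 - y) * (1 - y) = 1 - x.
    have -> : (1 - y) * (1 - y) = 1 - (y + y) + y * y by ncring.
    by rewrite yE; ncring.
  by rewrite /x opprB addrC subrK scalerA -rmorphM mulfV // rmorph1 scale1r.
- move=> z za; apply/commrZ/commrB; first exact: commr1.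
  by apply: yc; apply: commrB; [exact: commr1 | exact: commrZ].
Qed.

Lemma scale_i_star x : star ('i *: x) = - ('i *: star x).
Proof. by rewrite starZ conjCi scaleNr. Qed.

Lemma scale_ii x y : ('i *: x) * ('i *: y) = - (x * y).
Proof. by rewrite -scalerAl -scalerAr scalerA -expr2 sqrCi scaleN1r. Qed.

(** The element [u = b + i c] satisfies [u^* u = r^2], hence [nrm u = r], and [b] and [i c] are the
    half sum and half difference of [u] and [u^*]. *)
Lemma nrm_cartesian b c r : sa b -> sa c -> GRing.comm b c -> 0 <= r ->
  b * b + c * c = rsc A (r * r) -> nrm b <= r /\ nrm c <= r.
Proof.
move=> sb sc bc r0 bcr.
pose u := b + 'i *: c.
have su : star u = b - 'i *: c by rewrite starD scale_i_star sb sc.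
have nu : nrm u = r.
  apply/eqP; rewrite -(@eqrXn2 _ 2) ?nrm_ge0 //; apply/eqP.
  rewrite -nrm_starM su.
  have -> : (b - 'i *: c) * u = rsc A (r * r).
    rewrite mulrBl !mulrDr scale_ii -bcr -scalerAl -scalerAr bc; ncring.
  by rewrite nrm_rsc ger0_norm ?mulr_ge0 // expr2.
have nsu : nrm (star u) = r by rewrite nrm_star.
have half_le z : z + z = u + star u \/ z + z = u - star u -> nrm z <= r.
  move=> h; have : nrm (z + z) <= r + r.
    by case: h => ->; rewrite -{1}nu -nsu; [exact: nrmD | exact: nrmB].
  have -> : z + z = 2%:C *: z by rewrite rmorphD rmorph1 scalerDl scale1r.
  rewrite nrmZr ger0_norm //; lra.
split; first by apply: half_le; left; rewrite su /u; ncring.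
have -> : nrm c = nrm ('i *: c).
  by rewrite nrmZ -[X in Normc.normc X]complexiE /= expr0n expr1n add0r sqrtr1 mul1r.
by apply: half_le; right; rewrite su /u; ncring.
Qed.

(** For a root [c] of [1 - b^2] commuting with [b], [b^2 + c^2 = 1] forces [nrm c <= 1]. *)
Lemma nrm_1_sub_sqr b : sa b -> nrm b <= 1 -> nrm (1 - b * b) <= 1.
Proof.
move=> sb b1.
have bb1 : nrm (b * b) <= 1.
  by rewrite nrm_sa_sqr // expr2; have := nrm_ge0 b; nra.
have [y [_ yE ys yc]] := sqrt_iteration bb1.
have sy : sa y by apply: ys; rewrite starM sb.
pose c := 1 - y.
have cc : c * c = 1 - b * b.
  have -> : c * c = 1 - (y + y) + y * y by rewrite /c; ncring.
  by rewrite yE; ncring.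
have sc : sa c by rewrite starB star1 sy.
have bc : GRing.comm b c.
  apply: commrB; first exact: commr1.
  by apply/yc/commrM.
have [] := @nrm_cartesian b c 1 sb sc bc ler01.
  by rewrite cc mulr1 rsc1; ncring.
move=> _ c1; rewrite -cc nrm_sa_sqr // expr2; have := nrm_ge0 c; nra.
Qed.

Lemma sqr_nrm_sub b t : sa b -> nrm (b * b) <= t -> nrm (rsc A t - b * b) <= t.
Proof.
move=> sb bt.
have [t0|t0] := eqVneq t 0.
  move: bt; rewrite t0 rsc0 sub0r nrmN //.
have tp : 0 < t by rewrite lt_def t0 (le_trans (nrm_ge0 _) bt).
pose q := Num.sqrt t.
have q0 : 0 < q by rewrite sqrtr_gt0.
have qq : q * q = t by rewrite -expr2 sqr_sqrtr // ltW.
pose b' := (q^-1)%:C *: b.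
have sb' : sa b' by rewrite starZr sb.
have b'E : b * b = t%:C *: (b' * b').
  rewrite -scalerAl -scalerAr !scalerA -!rmorphM -qq.
  by rewrite mulfK ?gt_eqF // mulfV ?gt_eqF // rmorph1 scale1r.
have b'1 : nrm b' <= 1.
  rewrite nrmZr gtr0_norm ?invr_gt0 // mulrC ler_pdivrMr // mul1r.
  by rewrite -ler_sqr ?nnegrE ?nrm_ge0 ?(ltW q0) // -nrm_sa_sqr // expr2 qq.
rewrite b'E -scalerBr nrmZr gtr0_norm //.
by rewrite -[leRHS]mulr1 ler_pM2l // nrm_1_sub_sqr.
Qed.

Lemma sqr_pos b : sa b -> pos (b * b).
Proof.
move=> sb; split; first by rewrite starM sb.
by exists (nrm (b * b)); [exact: nrm_ge0 | exact: sqr_nrm_sub].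
Qed.

(** Writing [a] as a square frees the radius in [pos]: any bound of the norm serves. *)
Lemma pos_nrm_sub a t : pos a -> nrm a <= t -> nrm (rsc A t - a) <= t.
Proof. by move=> /pos_sqrt[b [/pos_sa sb <- _]]; apply: sqr_nrm_sub. Qed.

Lemma sa_sqr0 v : sa v -> v * v = 0 -> v = 0 :> A.
Proof.
move=> sv v0; apply/nrm0_eq0/eqP; rewrite -sqrf_eq0 -nrm_sa_sqr //.
by rewrite v0 nrm0.
Qed.

Lemma sa_cube0 v : sa v -> v * v * v = 0 -> v = 0.
Proof.
move=> sv v0; apply: sa_sqr0 => //; apply: sa_sqr0; first by rewrite starM sv.
by rewrite mulrA v0 mul0r.
Qed.

Lemma star_mul0 x : star x * x = 0 -> x = 0.
Proof.
by move=> h; apply/nrm0_eq0/eqP; rewrite -sqrf_eq0 -nrm_starM h nrm0.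
Qed.

(** Roots of [a] and [- a] commute and their squares add up to 0: this is [nrm_cartesian] for
    [r = 0]. *)
Lemma pos_anti a : pos a -> pos (- a) -> a = 0.
Proof.
move=> /pos_sqrt[b [/pos_sa sb bb bc]] /pos_sqrt[d [/pos_sa sd dd dc]].
have bd : GRing.comm b d.
  by apply: dc; apply: commrN; rewrite -bb; apply: commrM.
have h : b * b + d * d = rsc A (0 * 0) by rewrite bb dd mulr0 rsc0; ncring.
have [b0 _] := nrm_cartesian sb sd bd (lexx 0) h.
have -> : a = b * b by [].
by rewrite (@nrm0_eq0 _ _ b) ?mul0r //; apply/le_anti; rewrite b0 nrm_ge0.
Qed.

Lemma pos_comm_mul a b : pos a -> pos b -> GRing.comm a b -> pos (a * b).
Proof.
move=> /pos_sqrt[c [/pos_sa sc <- cc]] /pos_sqrt[d [/pos_sa sd <- dc]] ab.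
have dc1 : GRing.comm c d.
  by apply/dc/commr_sym/cc/commr_sym.
have -> : c * c * (d * d) = (c * d) * (c * d).
  by rewrite -!mulrA; congr (_ * _); rewrite !mulrA dc1.
by apply: sqr_pos; rewrite starM sc sd dc1.
Qed.

Lemma sa_nrm_sub a t : sa a -> nrm a <= t -> pos (rsc A t - a).
Proof.
move=> sa_a at'; split; first by rewrite starB star_rsc sa_a.
exists t; first exact: le_trans (nrm_ge0 _) at'.
by rewrite opprB addrC subrK.
Qed.

Lemma sa_nrm_add a t : sa a -> nrm a <= t -> pos (rsc A t + a).
Proof. by move=> sa_a at'; rewrite -[a]opprK; apply: sa_nrm_sub; rewrite ?nrmN // starN sa_a. Qed.

Lemma pos_nrm_le a t : 0 <= t -> pos a -> pos (rsc A t - a) -> nrm a <= t.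
Proof.
move=> t0 /pos_sqrt[b [/pos_sa sb bb bc]] /pos_sqrt[d [/pos_sa sd dd dc]].
have bd : GRing.comm b d.
  by apply: dc; apply: commrB; [exact: rsc_comm | rewrite -bb; apply: commrM].
pose q := Num.sqrt t.
have h : b * b + d * d = rsc A (q * q).
  by rewrite bb dd -expr2 sqr_sqrtr //; ncring.
have [bq _] := nrm_cartesian sb sd bd (sqrtr_ge0 t) h.
by rewrite -bb nrm_sa_sqr // -(sqr_sqrtr t0) ler_sqr ?nnegrE ?nrm_ge0 ?sqrtr_ge0.
Qed.

(** The product of the two commuting positive elements is [t^2 - y^2], which bounds
    [nrm (y * y)]. *)
Lemma sa_nrm_le y t : 0 <= t -> sa y -> pos (rsc A t - y) -> pos (rsc A t + y) ->
  nrm y <= t.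
Proof.
move=> t0 sy p1 p2.
have : pos ((rsc A t - y) * (rsc A t + y)).
  apply: pos_comm_mul => //; rewrite /GRing.comm.
  by rewrite !mulrDl !mulrDr !mulNr !mulrN (rsc_comm t y); ncring.
have -> : (rsc A t - y) * (rsc A t + y) = rsc A (t * t) - y * y.
  by rewrite mulrBl !mulrDr (rsc_comm t y) rsc_mul; ncring.
move/(pos_nrm_le (mulr_ge0 t0 t0) (sqr_pos sy)).
by rewrite nrm_sa_sqr // -expr2 ler_sqr ?nnegrE ?nrm_ge0.
Qed.

Lemma pos_closed a : (forall e, 0 < e -> pos (a + rsc A e)) -> pos a.
Proof.
move=> h.
have sa_a : sa a.
  have [s _] := h _ ltr01; move: s; rewrite starD star_rsc; exact: addIr.
(* This radius bounds [nrm (a + rsc A e)] for all [e <= 1], so one radius serves all of them in the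
   limit. *)
split=> //; exists (nrm a + 1); first by rewrite addr_ge0 ?nrm_ge0.
apply/ler_addgt0Pr => e0 e00; pose e := Num.min 1 e0.
have e1 : e <= 1 by rewrite ge_min lexx.
have ee : e <= e0 by rewrite ge_min lexx orbT.
have e0' : 0 < e by rewrite lt_min ltr01.
have /(pos_nrm_sub (h e e0')) : nrm (a + rsc A e) <= nrm a + 1.
  by apply: le_trans (nrmD _ _) _; rewrite nrm_rsc gtr0_norm //; lra.
set t := nrm a + 1 => k.
have -> : rsc A t - a = (rsc A t - (a + rsc A e)) + rsc A e by ncring.
by apply: le_trans (nrmD _ _) _; rewrite nrm_rsc gtr0_norm //; lra.
Qed.

Lemma pos_conj_sa a v : pos a -> sa v -> GRing.comm a v -> pos (v * a * v).
Proof.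
move=> pa sv av; have [b [/pos_sa sb bb bc]] := pos_sqrt pa.
have bv : GRing.comm v b by apply/bc/commr_sym.
have -> : v * a * v = (b * v) * (b * v) by rewrite -bb !mulrA bv.
by apply: sqr_pos; rewrite starM sb sv bv.
Qed.

(* For [c = |a|], the element [w = c - a] satisfies [w^2 = 2 c w]; with
   [v = |w| - w] this gives [v^3 = 2 v |w| v = - 4 v c v], hence [v = 0]. *)
Lemma pos_abs a : sa a -> exists c, [/\ pos c, c * c = a * a,
  forall z, GRing.comm z a -> GRing.comm z c & pos (c - a)].
Proof.
move=> sa_a; have [c [pc cc cz]] := pos_sqrt (sqr_pos sa_a).
have ca z : GRing.comm z a -> GRing.comm z c by move=> za; apply/cz/commrM.
exists c; split => //.
have sc := pos_sa pc.
have ac : GRing.comm a c by exact: ca.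
have [w wE] : exists w, w = c - a by exists (c - a).
have sw : sa w by rewrite wE starB sa_a sc.
have cw : GRing.comm c w by rewrite wE; apply: commrB => //; exact: commr_sym.
have ww : w * w = c * w + c * w.
  transitivity (c * w + c * w + (a * a - c * c) + (c * a - a * c)).
    by rewrite wE; ncring.
  by rewrite cc ac !subrr !addr0.
have [e [pe ee ez]] := pos_sqrt (sqr_pos sw).
have ew : GRing.comm w e by apply: ez; apply: commrM.
have ce : GRing.comm c e by apply: ez; apply: commrM.
have se := pos_sa pe.
have [v vE] : exists v, v = e - w by exists (e - w).
have sv : sa v by rewrite vE starB se sw.
have ev : GRing.comm e v by rewrite vE; apply: commrB => //; exact: commr_sym.
have cv : GRing.comm c v by rewrite vE; apply: commrB.
have vv : v * v = e * v + e * v.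
  transitivity (e * v + e * v + (w * w - e * e) + (e * w - w * e)).
    by rewrite vE; ncring.
  by rewrite ee ew !subrr !addr0.
have vvw : v * v = - (w * v + w * v).
  transitivity (- (w * v + w * v) + (e * e - w * w) + (w * e - e * w)).
    by rewrite vE; ncring.
  by rewrite ee ew !subrr !addr0.
have wv : GRing.comm w v by rewrite vE; apply: commrB.
have v3 : v * v * v = v * e * v + v * e * v by rewrite vv mulrDl ev.
have v3' : - (v * v * v) = (v * c * v + v * c * v) + (v * c * v + v * c * v).
  have -> : - (v * v * v) = w * v * v + w * v * v by rewrite vvw; ncring.
  have -> : w * v * v = - (w * (w * v) + w * (w * v)).
    by rewrite -mulrA vvw; ncring.
  rewrite !mulrA ww.
  have -> : - ((c * w + c * w) * v + (c * w + c * w) * v) =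
     c * - (w * v + w * v) + c * - (w * v + w * v) by ncring.
  by rewrite -vvw mulrA cv; ncring.
have p1 : pos (v * v * v).
  by rewrite v3; apply: posD; apply: pos_conj_sa.
have p2 : pos (- (v * v * v)).
  by rewrite v3'; apply: posD; apply: posD; apply: pos_conj_sa.
have v0 := sa_cube0 sv (pos_anti p1 p2).
have -> : c - a = e - v by rewrite vE wE; ncring.
by rewrite v0 subr0.
Qed.

(* Write [t = - y^* y] and [s = y y^*].  From [y (1 + t) = (1 - s) y] one gets
   [nrm (t (1 + t)^2) <= nrm t], and [t (1 + t)^2 >= t + 2 t^2] then forces [t = 0]. *)
Lemma neg_star_mul0 y : nrm y <= 1 -> pos (- (star y * y)) -> y = 0.
Proof.
move=> y1 pt; set t := - (star y * y) in pt.
have st := pos_sa pt.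
pose s := y * star y.
(* Up to sign these are twice the real and imaginary parts of [y]; their squares add up to
   [2 (y y^* + y^* y)], so [s - t] is positive. *)
have sqrs : (y + star y) * (y + star y) + ('i *: (y - star y)) * ('i *: (y - star y)) =
    (s - t) + (s - t).
  by rewrite scale_ii /s /t; ncring.
have ps : pos s.
  have : pos ((s - t) + (s - t)).
    rewrite -sqrs; apply: posD; apply: sqr_pos; first by rewrite starD starK addrC.
    by rewrite scale_i_star starB starK -scalerN opprB.
  move/pos_double => h; have -> : s = (s - t) + t by ncring.
  exact: posD.
have ns : nrm s <= 1.
  apply: le_trans (nrmM _ _) _; rewrite nrm_star; have := nrm_ge0 y; nra.
have n1s : nrm (1 - s) <= 1 by rewrite -(rsc1 A); apply: pos_nrm_sub.
pose u := t * (1 + t) * (1 + t).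
pose tau := nrm t.
have nt : nrm y ^+ 2 = tau by rewrite -nrm_starM -nrmN.
have nu : nrm u <= tau.
  have -> : u = - (star ((1 - s) * y) * ((1 - s) * y)).
    have -> : (1 - s) * y = y * (1 + t) by rewrite /s /t; ncring.
    by rewrite starM starD star1 st /u /t; ncring.
  rewrite nrmN nrm_starM -nt ler_sqr ?nnegrE ?nrm_ge0 //.
  apply: le_trans (nrmM _ _) _; rewrite -[leRHS]mul1r.
  by rewrite ler_wpM2r ?nrm_ge0.
have p1 : pos (rsc A tau - u).
  by apply: sa_nrm_sub => //; rewrite /u !starM starD star1 st mulrA; ncring.
have p2 : pos (t * t * t) by apply: pos_conj_sa.
have p3 : pos ((t - rsc A tau) * (t - rsc A tau)).
  by apply: sqr_pos; rewrite starB star_rsc st.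
have tau0 : 0 <= tau by exact: nrm_ge0.
(* Adding [t^3] and [2 (t - tau)^2] to [tau - u] cancels the higher powers of [t]. The resulting
   norm bound is [tau + 4 tau^2 <= tau + 2 tau^2]. *)
have : pos (rsc A (tau + 2 * tau * tau) - (1 + 4 * tau)%:C *: t).
  have := posD (posD p1 p2) (posD p3 p3); congr (pos _).
  have -> : (t - rsc A tau) * (t - rsc A tau) =
     t * t - (rsc A tau * t + rsc A tau * t) + rsc A tau * rsc A tau.
    by rewrite mulrBl !mulrBr (rsc_comm tau t); ncring.
  rewrite -rscM !rscD !rsc_mul rsc1.
  have -> : rsc A 4 = 1 + 1 + 1 + 1 by rewrite -rsc1 -!rscD; congr (rsc A _); lra.
  have -> : rsc A 2 = 1 + 1 by rewrite -rsc1 -!rscD; congr (rsc A _); lra.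
  by rewrite /u; ncring.
have q : 0 <= 1 + 4 * tau by lra.
move/(pos_nrm_le _ (posZ q pt)).
rewrite nrmZr ger0_norm // -/tau.
have tt : 0 <= 2 * tau * tau by rewrite !mulr_ge0.
have ht : 0 <= tau + 2 * tau * tau by lra.
move=> /(_ ht) hh.
have tau00 : tau = 0 by nra.
apply: nrm0_eq0; apply/eqP; rewrite -sqrf_eq0 nt; exact/eqP.
Qed.

(** For [a = x^* x], [c = |a|] and [w = c - a], twice the negative part of [a], one has
    [(x w)^* (x w) = w a w = - w c w]. By [neg_star_mul0] this forces [x w = 0], and then
    [w^3 = 2 w c w = 0]. *)
Lemma star_mul_pos x : pos (star x * x).
Proof.
have [a aE] : exists a : A, a = star x * x by exists (star x * x).
rewrite -aE; have sa_a : sa a by rewrite aE starM starK.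
have [c [pc cc ca pw]] := pos_abs sa_a.
have ac : GRing.comm a c by exact: ca.
have [w wE] : exists w, w = c - a by exists (c - a).
rewrite -wE in pw.
have aw : a * w = - (c * w) by rewrite wE !mulrBr cc ac; ncring.
have sw := pos_sa pw.
have cw : GRing.comm c w by rewrite wE; apply: commrB => //; exact: commr_sym.
have yy : star (x * w) * (x * w) = - (w * c * w) :> A.
  rewrite starM sw; transitivity (w * ((star x * x) * w) : A); first by ncring.
  by rewrite -aE aw; ncring.
(* Scales [x * w] into the unit ball, as [neg_star_mul0] demands. *)
pose r := (1 + nrm (x * w))^-1.
have r0 : 0 < r by rewrite invr_gt0 ltr_pwDl ?nrm_ge0.
have w0 : r%:C *: (x * w) = 0.
  apply: neg_star_mul0.
    rewrite nrmZr gtr0_norm // mulrC ler_pdivrMr ?mul1r; last by rewrite -invr_gt0.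
    by rewrite lerDr.
  rewrite starZr -scalerAl -scalerAr scalerA -rmorphM -scalerN yy opprK.
  by apply: posZ; [apply: mulr_ge0; apply: ltW | apply: pos_conj_sa (pos_sa pw) cw].
have {w0 r0 r} xw0 : x * w = 0.
  apply/eqP; move/eqP: w0; rewrite scaler_eq0 => /orP[/eqP|//].
  by rewrite -(rmorph0 (real_complex R)) => /complexI r00; move: r0; rewrite r00 ltxx.
have w3 : w * w * w = 0.
  have ww : w * w = c * w + c * w by rewrite {1}wE mulrBl aw; ncring.
  by rewrite -mulrA ww mulrDr !mulrA -[w * c * w]opprK -yy xw0 mulr0 oppr0 addr0.
have -> : a = c - w by rewrite wE; ncring.
by rewrite (sa_cube0 sw w3) subr0.
Qed.

End Positivity.

Section PositivityOrder.
Variables (R : realType) (A : cstarAlgType R).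
Implicit Types (x y z a b c d v : A) (r s t : R).

Lemma posP a : pos a <-> exists b, a = star b * b.
Proof.
split=> [/pos_sqrt[b [/pos_sa sb <- _]]|[b ->]]; last exact: star_mul_pos.
by exists b; rewrite sb.
Qed.

Lemma pos_conj a x : pos a -> pos (star x * a * x).
Proof.
move=> /posP[b ->]; apply/posP; exists (b * x).
by rewrite starM !mulrA.
Qed.

Lemma pos_conj_nrm a x : star a = a ->
  pos ((nrm a)%:C *: (star x * x) - star x * a * x).
Proof.
move=> sa_a; have -> : (nrm a)%:C *: (star x * x) - star x * a * x =
    star x * (rsc A (nrm a) - a) * x.
  by rewrite mulrBr mulrBl -rscM mulrA (rsc_comm _ (star x)).
by apply/pos_conj/sa_nrm_sub.
Qed.

Lemma pos_nrm_mono a b : pos a -> pos (b - a) -> nrm a <= nrm b.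
Proof.
move=> pa pba; apply: pos_nrm_le => //; first exact: nrm_ge0.
have -> : rsc A (nrm b) - a = (rsc A (nrm b) - b) + (b - a) by ncring.
apply: posD => //; apply: sa_nrm_sub => //.
have -> : b = (b - a) + a by ncring.
exact/pos_sa/posD.
Qed.

Lemma pos_sum_eq0 (T : finType) (F : T -> A) :
  (forall i, pos (F i)) -> \sum_i F i = 0 -> forall i, F i = 0.
Proof.
move=> pF F0 i; apply: pos_anti => //.
move: F0; rewrite (bigD1 i) //= => /eqP; rewrite addr_eq0 => /eqP ->.
by rewrite opprK; apply: pos_sum.
Qed.

(** For [w = c - a], [w (c + a) w = 0] is a sum of two positive elements; both vanish, and so does
    their difference [w^3]. *)
Lemma pos_sqrt_unique a c : pos a -> pos c -> GRing.comm a c -> a * a = c * c -> a = c.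
Proof.
move=> pa pc ac aacc.
have [w wE] : exists w, w = c - a by exists (c - a).
have sw : star w = w by rewrite wE starB !pos_sa.
have cw : GRing.comm c w by rewrite wE; apply: commrB => //; exact: commr_sym.
have aw : GRing.comm a w by rewrite wE; apply: commrB.
have h : (c + a) * w = 0.
  transitivity ((c * c - a * a) + (a * c - c * a)); first by rewrite wE; ncring.
  by rewrite aacc ac !subrr addr0.
have h2 : w * c * w + w * a * w = 0.
  by transitivity (w * ((c + a) * w)); [ncring | rewrite h mulr0].
have p1 := pos_conj_sa pc sw cw; have p2 := pos_conj_sa pa sw aw.
have h3 : w * c * w = - (w * a * w) by apply/eqP; rewrite -addr_eq0 h2.
have a0 : w * a * w = 0 by apply: pos_anti; rewrite -?h3.
have c0 : w * c * w = 0 by rewrite h3 a0 oppr0.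
have w0 : w = 0.
  apply: sa_cube0 => //; transitivity (w * c * w - w * a * w); last by rewrite a0 c0 subrr.
  by rewrite {2}wE; ncring.
by apply/esym/eqP; rewrite -subr_eq0 -wE w0.
Qed.

End PositivityOrder.

(* If [phi a] is positive then [phi |a| = |phi a| = phi a]. *)
Lemma pos_reflect (R : realType) (A D : cstarAlgType R) (phi : A -> D) (a : A) :
  {morph phi : x y / x + y} -> {morph phi : x y / x * y} ->
  {morph phi : x / star x} -> injective phi -> pos (phi a) -> pos a.
Proof.
move=> phiD phiM phiS phiI pa.
have sa_a : star a = a by apply: phiI; rewrite phiS pos_sa.
have [c [/posP[d dE] cc ca _]] := pos_abs sa_a.
have pc : pos (phi c) by rewrite dE phiM phiS; exact: star_mul_pos.
suff -> : a = c by apply/posP; exists d.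
apply: phiI; apply: pos_sqrt_unique => //; last by rewrite -!phiM cc.
by rewrite /GRing.comm -!phiM; congr phi; apply: ca.
Qed.

Section CoordinateConvergence.
Variable R : realType.

(** Here [g] is a coordinate: an entry of a matrix, or the value of a net at an index. The algebra
    [E] is one whose completeness is still to be shown. *)
Lemma cauchy_coord_cvg (E : preCstarAlgType R) (C : cstarAlgType R) (g : E -> C)
    (F : set_system (normed_of E)) :
  (forall x y, cnorm (g x - g y) <= cnorm (x - y)) ->
  ProperFilter F -> cauchy F ->
  exists l : C, forall e : R, 0 < e -> F [set x : normed_of E | nrm (l - g x) < e].
Proof.
move=> gc FF cF.
pose v : normed_of E -> normed_of C := g.
have cG : cauchy (v @ F).
  apply/cauchyP => d d0.
  have /cauchyP/(_ _ d0)[x Fx] := cF.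
  exists (v x); rewrite /nbhs /=; apply: filterS Fx => y.
  rewrite -!ball_normE /=; apply: le_lt_trans; exact: gc.
have cvG : cvg (v @ F) by exact: (@cauchy_cvg_cnorm R C _ _ cG).
have /cvg_ex[l /= Fl] := cvG.
exists l => e e0.
have e0C : 0 < e%:C :> R[i] by rewrite ltcR.
have /cvgrPdist_lt/(_ _ e0C) := Fl.
rewrite near_simpl; apply: filterS => x /=.
by rewrite normed_ofE cnormE ltcR.
Qed.

End CoordinateConvergence.

(** * Matrix algebras *)

Section MatrixStar.
Variables (R : realType) (C : cstarAlgType R).

Lemma mxstarK m n : cancel (@mxstar R C m n) (@mxstar R C n m).
Proof. by move=> X; apply/matrixP => i j; rewrite !mxE starK. Qed.

Lemma mxstarD m n (X Y : 'M[C]_(m, n)) : mxstar (X + Y) = mxstar X + mxstar Y.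
Proof. by apply/matrixP => i j; rewrite !mxE starD. Qed.

Lemma mxstarM m n k (X : 'M[C]_(m, n)) (Y : 'M[C]_(n, k)) :
  mxstar (X *m Y) = mxstar Y *m mxstar X.
Proof.
apply/matrixP => i j; rewrite !mxE star_sum; apply: eq_bigr => l _.
by rewrite !mxE starM.
Qed.

End MatrixStar.

Section MatrixNorm.
Variables (R : realType) (C : cstarAlgType R) (n : nat).
Implicit Types (v w : 'cV[C]_n) (X Y : 'M[C]_n) (s t : R).

Definition ip v w : C := \sum_i star (v i 0) * w i 0.

Lemma ipDl v1 v2 w : ip (v1 + v2) w = ip v1 w + ip v2 w.
Proof. by rewrite -big_split; apply: eq_bigr => i _; rewrite !mxE starD mulrDl. Qed.

Lemma ipDr v w1 w2 : ip v (w1 + w2) = ip v w1 + ip v w2.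
Proof. by rewrite -big_split; apply: eq_bigr => i _; rewrite !mxE mulrDr. Qed.

(** The native scalars of ['M[C]_(m, k)] are the elements of [C]; complex numbers act through their
    multiples of 1. *)
Definition scale_mx m k (c : R[i]) (X : 'M[C]_(m, k)) : 'M[C]_(m, k) := c%:A *: X.

Lemma scale_mxE m k (c : R[i]) (X : 'M[C]_(m, k)) i j : scale_mx c X i j = c *: X i j.
Proof. by rewrite mxE -scalerAl mul1r. Qed.

Lemma ipZl (c : R[i]) v w : ip (scale_mx c v) w = c^*%R *: ip v w.
Proof.
rewrite scaler_sumr; apply: eq_bigr => i _.
by rewrite scale_mxE starZ scalerAl.
Qed.

Lemma ipZr (c : R[i]) v w : ip v (scale_mx c w) = c *: ip v w.
Proof.
rewrite scaler_sumr; apply: eq_bigr => i _.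
by rewrite scale_mxE scalerAr.
Qed.

Lemma ip_pos v : pos (ip v v).
Proof. by apply: pos_sum => i _; exact: star_mul_pos. Qed.

Lemma ip_entry_le v i : pos (ip v v - star (v i 0) * v i 0).
Proof.
rewrite /ip (bigD1 i) //= addrC addrK.
by apply: pos_sum => j _; exact: star_mul_pos.
Qed.

Lemma ip_adj X v w : ip (X *m v) w = ip v (mxstar X *m w).
Proof.
rewrite /ip.
transitivity (\sum_i \sum_j star (v j 0) * star (X i j) * w i 0).
  apply: eq_bigr => i _; rewrite mxE star_sum mulr_suml.
  by apply: eq_bigr => j _; rewrite starM.
rewrite exchange_big; apply: eq_bigr => j _; rewrite mxE mulr_sumr.
by apply: eq_bigr => i _; rewrite mxE mulrA.
Qed.

(* [X] is bounded by [t] as an operator on the Hilbert module C^n. *)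
Definition mxbounded X t :=
  forall v, pos ((t * t)%:C *: ip v v - ip (X *m v) (X *m v)).

Lemma mxboundedW X s t : 0 <= s -> s <= t -> mxbounded X s -> mxbounded X t.
Proof.
move=> s0 st Xs v.
have -> : (t * t)%:C *: ip v v - ip (X *m v) (X *m v) =
   (t * t - s * s)%:C *: ip v v + ((s * s)%:C *: ip v v - ip (X *m v) (X *m v)).
  by rewrite rmorphB scalerBl addrA subrK.
apply: posD => //; apply: posZ; last exact: ip_pos.
by rewrite subr_ge0; nra.
Qed.

(** With [p = X v], [q = Y v] and [V = <v, v>], it rests on the identity [s t ((s + t)^2 V - |p +
    q|^2) = t (s + t) (s^2 V - |p|^2) + s (s + t) (t^2 V - |q|^2) + |t p - s q|^2], where [|z|^2] is
    [<z, z>]. *)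
Lemma mxboundedD_gt0 X Y s t : 0 < s -> 0 < t ->
  mxbounded X s -> mxbounded Y t -> mxbounded (X + Y) (s + t).
Proof.
move=> s0 t0 Xs Yt v.
have st0 : 0 < s * t by rewrite mulr_gt0.
apply: (@posZK _ _ (s * t)) => //.
have [pX pY] := (Xs v, Yt v).
set p := X *m v in pX; set q := Y *m v in pY; set V := ip v v in pX pY *.
have pq := ip_pos (scale_mx t%:C p + scale_mx (- s)%:C q).
have h1 : 0 <= t * (s + t) by rewrite mulr_ge0 ?addr_ge0 ?(ltW s0) ?(ltW t0).
have h2 : 0 <= s * (s + t) by rewrite mulr_ge0 ?addr_ge0 ?(ltW s0) ?(ltW t0).
have := posD (posD (posZ h1 pX) (posZ h2 pY)) pq; congr (pos _).
rewrite mulmxDl -/p -/q !ipDl !ipDr !ipZl !ipZr !scalerA.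
rewrite !scalerBr !scalerDr !scalerA.
have rc r : (r%:C)^*%R = r%:C :> R[i] by exact: conjc_real.
rewrite !rc -!rmorphM.
set pp := ip p p; set pq' := ip p q; set qp := ip q p; set qq := ip q q.
have zr r (x : C) : r%:C *: x = rsc C r * x by rewrite rscM.
have -> : s * t * ((s + t) * (s + t)) = t * (s + t) * (s * s) + s * (s + t) * (t * t).
  by ring.
have -> : t * (s + t) = t * t + s * t by ring.
have -> : s * (s + t) = s * s + s * t by ring.
rewrite !zr !(rscD _ (_ * _) (_ * _)).
have -> : rsc C (- s * - s) = rsc C (s * s) by congr (rsc C _); ring.
have -> : rsc C (t * - s) = - rsc C (s * t) by rewrite -rscN; congr (rsc C _); ring.
have -> : rsc C (- s * t) = - rsc C (s * t) by rewrite -rscN; congr (rsc C _); ring.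
ncring.
Qed.

End MatrixNorm.

Section MatrixNormTheory.
Variables (R : realType) (C : cstarAlgType R) (n : nat).
Implicit Types (v w : 'cV[C]_n.+1) (X Y : 'M[C]_n.+1) (s t : R).

Lemma mxbounded_delta (x : C) (i j : 'I_n.+1) :
  mxbounded (x *: delta_mx i j) (nrm x).
Proof.
move=> v.
have E : (x *: delta_mx i j) *m v = \col_k ((k == i)%:R * (x * v j 0)).
  apply/matrixP => k l; rewrite !mxE (bigD1 j) //= big1 ?addr0.
    by rewrite !mxE eqxx andbT ord1; case: (k == i); rewrite ?mulr1 ?mulr0 ?mul1r ?mul0r.
  by move=> h /negbTE hj; rewrite !mxE hj andbF mulr0 mul0r.
rewrite E; have -> : ip (\col_k ((k == i)%:R * (x * v j 0))) (\col_k ((k == i)%:R * (x * v j 0))) =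
    star (v j 0) * (star x * x) * v j 0.
  rewrite /ip (bigD1 i) //= big1 ?addr0.
    by rewrite !mxE eqxx mul1r starM !mulrA.
  by move=> k /negbTE ki; rewrite !mxE ki mul0r mulr0.
have h := pos_conj_nrm (v j 0) (pos_sa (star_mul_pos x)).
rewrite nrm_starM expr2 in h.
have := posD (posZ (mulr_ge0 (nrm_ge0 x) (nrm_ge0 x)) (ip_entry_le v j)) h.
by rewrite scalerBr addrA subrK.
Qed.

Lemma mxboundedD X Y s t : 0 <= s -> 0 <= t ->
  mxbounded X s -> mxbounded Y t -> forall e, 0 < e -> mxbounded (X + Y) (s + t + e).
Proof.
move=> s0 t0 Xs Yt e e0.
have e2 : 0 < e / 2 by rewrite divr_gt0.
have -> : s + t + e = (s + e / 2) + (t + e / 2) by field.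
apply: mxboundedD_gt0; rewrite ?ltr_wpDl //.
  by apply: mxboundedW s0 _ Xs; rewrite lerDl ltW.
by apply: mxboundedW t0 _ Yt; rewrite lerDl ltW.
Qed.

Lemma mxbounded0 t : mxbounded (0 : 'M[C]_n.+1) t.
Proof.
move=> v; rewrite mul0mx.
have -> : ip (0 : 'cV[C]_n.+1) 0 = 0 by rewrite /ip big1 // => i _; rewrite mxE mulr0.
by rewrite subr0; apply: posZ (ip_pos v); rewrite -expr2 sqr_ge0.
Qed.

Lemma mxbounded_entries X e : 0 < e ->
  mxbounded X (\sum_i \sum_j nrm (X i j) + e).
Proof.
(* Bounds up to arbitrarily small slack, which add up along the sum over the entries. *)
pose B (Z : 'M[C]_n.+1) (t : R) := 0 <= t /\ forall e, 0 < e -> mxbounded Z (t + e).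
suff : B X (\sum_i \sum_j nrm (X i j)) by move=> [_ h] /h.
have BD Z W s t : B Z s -> B W t -> B (Z + W) (s + t).
  move=> [s0 hs] [t0 ht]; split=> [|d d0]; first exact: addr_ge0.
  have d3 : 0 < d / 3 by rewrite divr_gt0.
  have -> : s + t + d = (s + d / 3) + (t + d / 3) + d / 3 by field.
  by apply: mxboundedD; [| | apply: hs | apply: ht | ] => //; apply: addr_ge0; rewrite // ltW.
have B0 : B 0 0 by split => // d d0; apply: mxbounded0.
rewrite {1}(matrix_sum_delta X).
elim/big_rec2: _ => // i Z s _ hs; apply: (BD) hs.
elim/big_rec2: _ => // j Z' s' _ hs; apply: (BD) hs.
split=> [|d d0]; first exact: nrm_ge0.
apply: mxboundedW (mxbounded_delta _ _ _); first exact: nrm_ge0.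
by rewrite lerDl ltW.
Qed.

Definition mxnrm X : R := inf [set t | 0 <= t /\ mxbounded X t].

Let bset X := [set t | 0 <= t /\ mxbounded X t].

Lemma mxnrm_has_inf X : has_inf (bset X).
Proof.
split; last by exists 0 => t [].
exists (\sum_i \sum_j nrm (X i j) + 1); split; last exact: mxbounded_entries.
by rewrite addr_ge0 // sumr_ge0 // => i _; rewrite sumr_ge0 // => j _; exact: nrm_ge0.
Qed.

Lemma mxnrm_le X t : 0 <= t -> mxbounded X t -> mxnrm X <= t.
Proof. by move=> t0 Xt; apply: ge_inf; [case: (mxnrm_has_inf X) | split]. Qed.

Lemma mxnrm_ge0 X : 0 <= mxnrm X.
Proof. by apply: lb_le_inf; [case: (mxnrm_has_inf X) | move=> t []]. Qed.

(** The infimum is attained because the positive cone is closed: passing from [m] to [m + d] costs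
    [d (2 m + d)] times [<v, v>], and [d] is chosen to keep this below [e]. *)
Lemma mxnrm_bounded X : mxbounded X (mxnrm X).
Proof.
move=> v; apply: pos_closed => e e0.
set m := mxnrm X; have m0 : 0 <= m := mxnrm_ge0 X.
set V := ip v v; have V0 := nrm_ge0 V.
pose K := (2 * m + 1) * (nrm V + 1).
have K0 : 0 < K by rewrite mulr_gt0 //; lra.
pose d := Num.min 1 (e / K).
have d0 : 0 < d by rewrite lt_min ltr01 divr_gt0.
have d1 : d <= 1 by rewrite ge_min lexx.
have dK : d * K <= e by rewrite -ler_pdivlMr // ge_min lexx orbT.
have [t [t0 Xt] tm] := inf_adherent d0 (mxnrm_has_inf X).
have {t0 Xt tm} := mxboundedW t0 (ltW tm : t <= m + d) Xt.
move=> /(_ v); rewrite -/V => h.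
have -> : (m * m)%:C *: V - ip (X *m v) (X *m v) + rsc C e =
   (((m + d) * (m + d))%:C *: V - ip (X *m v) (X *m v)) +
   (rsc C e - (d * (2 * m + d))%:C *: V).
  have -> : (m + d) * (m + d) = m * m + d * (2 * m + d) by ring.
  by rewrite rmorphD scalerDl; ncring.
apply: posD => //; apply: sa_nrm_sub.
  by rewrite starZr (pos_sa (ip_pos v)).
rewrite nrmZr ger0_norm; last by rewrite mulr_ge0 ?addr_ge0 ?mulr_ge0 ?(ltW d0).
apply: le_trans dK; rewrite /K -mulrA ler_pM2l //.
by apply: ler_pM => //; lra.
Qed.

Lemma mxnrm_entry X i j : nrm (X i j) <= mxnrm X.
Proof.
have h := mxnrm_bounded X (delta_mx j 0).
have e1 : ip (delta_mx j 0 : 'cV[C]_n.+1) (delta_mx j 0) = 1.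
  rewrite /ip (bigD1 j) //= big1 ?addr0; first by rewrite !mxE !eqxx star1 mulr1.
  by move=> k /negbTE kj; rewrite !mxE kj /= mulr0.
rewrite e1 in h.
have h2 := posD h (ip_entry_le (X *m delta_mx j 0) i).
rewrite addrA subrK -colE mxE in h2.
rewrite -ler_sqr ?nnegrE ?nrm_ge0 ?mxnrm_ge0 // -nrm_starM expr2.
apply: pos_nrm_le => //; last exact: star_mul_pos.
by rewrite mulr_ge0 ?mxnrm_ge0.
Qed.

Lemma mxnrm_le_entries X : mxnrm X <= \sum_i \sum_j nrm (X i j).
Proof.
apply/ler_addgt0Pr => e e0; apply: mxnrm_le; last exact: mxbounded_entries.
rewrite addr_ge0 ?(ltW e0) // sumr_ge0 // => i _.
by rewrite sumr_ge0 // => j _; exact: nrm_ge0.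
Qed.

Lemma mxnrmD X Y : mxnrm (X + Y) <= mxnrm X + mxnrm Y.
Proof.
apply/ler_addgt0Pr => e e0; apply: mxnrm_le.
  by rewrite !addr_ge0 ?mxnrm_ge0 ?ltW.
by apply: mxboundedD => //; [exact: mxnrm_ge0 | exact: mxnrm_ge0 | exact: mxnrm_bounded | exact: mxnrm_bounded].
Qed.

Lemma mxnrmM X Y : mxnrm (X *m Y) <= mxnrm X * mxnrm Y.
Proof.
apply: mxnrm_le => [|v]; first by rewrite mulr_ge0 ?mxnrm_ge0.
set s := mxnrm X; set t := mxnrm Y.
have h1 := mxnrm_bounded Y v; have h2 := mxnrm_bounded X (Y *m v).
have s20 : 0 <= s * s by rewrite -expr2 sqr_ge0.
have := posD (posZ s20 h1) h2.
rewrite scalerBr scalerA -rmorphM addrA subrK mulmxA -/t.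
have -> : s * s * (t * t) = s * t * (s * t) by ring.
exact.
Qed.

Lemma mxnrmZ_le (c : R[i]) X : mxnrm (scale_mx c X) <= Normc.normc c * mxnrm X.
Proof.
have c0 : 0 <= Normc.normc c by case: c => a b; exact: sqrtr_ge0.
apply: mxnrm_le => [|v]; first by rewrite mulr_ge0 ?mxnrm_ge0.
have -> : scale_mx c X *m v = scale_mx c (X *m v) by rewrite /scale_mx scalemxAl.
rewrite ipZl ipZr scalerA.
have -> : c^*%R * c = (Normc.normc c * Normc.normc c)%:C.
  rewrite mulrC -[c^*%R]/(c^*) -sqr_normc expr2 rmorphM normc_def.
  by case: c {c0} => a b; reflexivity.
set m := mxnrm X; pose k := Normc.normc c * Normc.normc c; rewrite -/k.
have k0 : 0 <= k by rewrite mulr_ge0.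
have := posZ k0 (mxnrm_bounded X v).
rewrite scalerBr scalerA -rmorphM -/m.
have -> : k * (m * m) = Normc.normc c * m * (Normc.normc c * m) by rewrite /k; ring.
exact.
Qed.

(** For [Y = X^* X] bounded by [t > 0], the inequalities [|t v - Y v|^2 >= 0] and
    [|Y v|^2 <= t^2 |v|^2] add up to [2 t |X v|^2 <= 2 t^2 |v|^2]. The slack [e] makes [t] positive,
    so that [2 t] can be divided out. *)
Lemma mxnrm_star_sqr X : mxnrm X ^+ 2 <= mxnrm (mxstar X *m X).
Proof.
set m := mxnrm (mxstar X *m X); have m0 : 0 <= m := mxnrm_ge0 _.
apply/ler_addgt0Pr => e e0.
pose q := Num.sqrt (m + e).
have me : 0 < m + e by rewrite ltr_wpDl.
have q0 : 0 <= q by exact: sqrtr_ge0.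
have qq : q * q = m + e by rewrite -expr2 sqr_sqrtr // ltW.
rewrite -qq -expr2 ler_sqr ?nnegrE ?mxnrm_ge0 //.
apply: mxnrm_le => // v; rewrite qq.
have [t tE] : exists t, t = m + e by exists (m + e).
rewrite -tE in me *.
have h := mxboundedW m0 (_ : m <= t) (mxnrm_bounded (mxstar X *m X)) v.
have {}h := h (ltac:(by rewrite tE lerDl ltW)).
apply: (@posZK _ _ (t + t)); first exact: addr_gt0.
have := posD h (ip_pos (scale_mx t%:C v + scale_mx (- 1)%:C (mxstar X *m X *m v))).
set Y := mxstar X *m X; congr (pos _).
have e1 : ip v (Y *m v) = ip (X *m v) (X *m v) by rewrite ip_adj mulmxA.
have e2 : ip (Y *m v) v = ip (X *m v) (X *m v).
  by rewrite ip_adj /Y mxstarM mxstarK -mulmxA -ip_adj.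
rewrite !ipDl !ipDr !ipZl !ipZr e1 e2.
have rc r : (r%:C)^*%R = r%:C :> R[i] by exact: conjc_real.
rewrite !rc !scalerA -!rmorphM scalerBr scalerA -rmorphM.
have zr r (x : C) : r%:C *: x = rsc C r * x by rewrite rscM.
rewrite !zr mulrDl !rscD mulrNN mulr1 rsc1 mulrN mulN1r mulr1 rscN; ncring.
Qed.

End MatrixNormTheory.

(** The alias carries the module structure over [R[i]], apart from the native one over [C]; the size
    [n.+1] keeps the algebra nontrivial. *)
Definition mxalg (R : realType) (C : cstarAlgType R) (n : nat) : Type := 'M[C]_n.+1.

Section MatrixCStar.
Variables (R : realType) (C : cstarAlgType R) (n : nat).

Local Notation M := (mxalg C n).

HB.instance Definition _ := GRing.NzRing.on M.

Lemma mxalg_scaleA (a b : R[i]) (X : M) : scale_mx a (scale_mx b X) = scale_mx (a * b) X.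
Proof. by apply/matrixP => i j; rewrite !scale_mxE scalerA. Qed.

Lemma mxalg_scale1 : left_id 1 (fun (a : R[i]) (X : M) => scale_mx a X : M).
Proof. by move=> X; apply/matrixP => i j; rewrite scale_mxE scale1r. Qed.

Lemma mxalg_scaleDr : right_distributive (fun (a : R[i]) (X : M) => scale_mx a X : M) +%R.
Proof. by move=> a X Y; apply/matrixP => i j; rewrite [RHS]mxE !scale_mxE mxE scalerDr. Qed.

Lemma mxalg_scaleDl (X : M) : {morph (fun a : R[i] => scale_mx a X : M) : a b / a + b}.
Proof. by move=> a b; apply/matrixP => i j; rewrite [RHS]mxE !scale_mxE scalerDl. Qed.

HB.instance Definition _ := GRing.Zmodule_isLmodule.Build R[i] M
  mxalg_scaleA mxalg_scale1 mxalg_scaleDr mxalg_scaleDl.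

Lemma mxalg_scaleE (a : R[i]) (X : M) : a *: X = scale_mx a X. Proof. by []. Qed.

Lemma mxalg_scaleAl (a : R[i]) (X Y : M) : a *: (X * Y) = a *: X * Y.
Proof. exact: (scalemxAl (a%:A) (X : 'M[C]_n.+1) (Y : 'M[C]_n.+1)). Qed.

Lemma mxalg_scaleAr (a : R[i]) (X Y : M) : a *: (X * Y) = X * (a *: Y).
Proof.
rewrite !mxalg_scaleE; apply/matrixP => i j; rewrite scale_mxE !mxE scaler_sumr.
by apply: eq_bigr => k _; rewrite scale_mxE scalerAr.
Qed.

HB.instance Definition _ := GRing.Lmodule_isLalgebra.Build R[i] M mxalg_scaleAl.
HB.instance Definition _ := GRing.Lalgebra_isAlgebra.Build R[i] M mxalg_scaleAr.

Definition mxalg_norm (X : M) : R[i] := (mxnrm X)%:C.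

Lemma mxalg_starK : involutive (fun X : M => mxstar X : M).
Proof. by move=> X; exact: mxstarK. Qed.

Lemma mxalg_starD : {morph (fun X : M => mxstar X : M) : x y / x + y}.
Proof. by move=> X Y; exact: mxstarD. Qed.

Lemma mxalg_starZ (c : R[i]) (X : M) : mxstar (c *: X) = c^*%R *: (mxstar X : M).
Proof. by apply/matrixP => i j; rewrite !mxalg_scaleE mxE !scale_mxE mxE starZ. Qed.

Lemma mxalg_starM (X Y : M) : mxstar (X * Y) = (mxstar Y : M) * mxstar X.
Proof. exact: mxstarM. Qed.

Lemma mxalg_normD (X Y : M) : mxalg_norm (X + Y) <= mxalg_norm X + mxalg_norm Y.
Proof. by rewrite /mxalg_norm -rmorphD lecR; exact: mxnrmD. Qed.

Lemma mxalg_normZ (c : R[i]) (X : M) : mxalg_norm (c *: X) = `|c| * mxalg_norm X.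
Proof.
rewrite /mxalg_norm normc_def -rmorphM; congr (_%:C).
rewrite mxalg_scaleE.
have -> : Num.sqrt (complex.Re c ^+ 2 + complex.Im c ^+ 2) = Normc.normc c by case: c.
apply/le_anti/andP; split; first exact: mxnrmZ_le.
have [->|c0] := eqVneq c 0; first by rewrite Normc.normc0 mul0r mxnrm_ge0.
have n0 : 0 < Normc.normc c.
  rewrite lt_def; apply/andP; split; last by case: c {c0} => a b; exact: sqrtr_ge0.
  by apply: contra c0 => /eqP /Normc.eq0_normc ->.
have := mxnrmZ_le c^-1 (scale_mx c X).
by rewrite mxalg_scaleA mulVf // mxalg_scale1 Normc.normcV mulrC ler_pdivlMr // mulrC.
Qed.

Lemma mxalg_norm0_eq0 (X : M) : mxalg_norm X = 0 -> X = 0.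
Proof.
move/(@complexI R) => X0; apply/matrixP => i j; rewrite mxE.
by apply: nrm0_eq0; apply/le_anti; rewrite nrm_ge0 -X0 mxnrm_entry.
Qed.

Lemma mxalg_normM (X Y : M) : mxalg_norm (X * Y) <= mxalg_norm X * mxalg_norm Y.
Proof. by rewrite /mxalg_norm -rmorphM lecR; exact: mxnrmM. Qed.

Lemma mxnrm_star_le (X : M) : mxnrm X <= mxnrm (mxstar X).
Proof.
have [->|X0] := eqVneq (mxnrm X) 0; first exact: mxnrm_ge0.
have Xp : 0 < mxnrm X by rewrite lt_def X0 mxnrm_ge0.
by rewrite -(ler_pM2r Xp) -expr2 (le_trans (mxnrm_star_sqr X)) ?mxnrmM.
Qed.

Lemma mxalg_norm_starM (X : M) : mxalg_norm ((mxstar X : M) * X) = mxalg_norm X ^+ 2.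
Proof.
rewrite /mxalg_norm -rmorphXn; congr (_%:C); apply/le_anti/andP; split.
  apply: le_trans (mxnrmM _ _) _; rewrite expr2 ler_wpM2r ?mxnrm_ge0 //.
  by rewrite -{2}(mxstarK X); exact: mxnrm_star_le.
exact: mxnrm_star_sqr.
Qed.

HB.instance Definition _ := isPreCStarAlgebra.Build R M
  mxalg_starK mxalg_starD mxalg_starZ mxalg_starM mxalg_normD
  mxalg_normZ mxalg_norm0_eq0 mxalg_normM mxalg_norm_starM.

Lemma mxalg_cauchy_cvg (F : set_system (normed_of M)) :
  ProperFilter F -> cauchy F -> cvg F.
Proof.
move=> FF cF.
have h (ij : 'I_n.+1 * 'I_n.+1) : exists l : C,
    forall e : R, 0 < e -> F [set X : normed_of M | nrm (l - (X : M) ij.1 ij.2) < e].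
  apply: (@cauchy_coord_cvg R M C (fun X => X ij.1 ij.2)) => // X Y.
  rewrite cnormE -[cnorm (X - Y)]/((mxnrm (X - Y))%:C) lecR.
  by have := mxnrm_entry (X - Y) ij.1 ij.2; rewrite !mxE.
have [l hl] := choice h.
pose L : M := \matrix_(i, j) l (i, j).
apply/cvg_ex; exists (L : normed_of M).
apply/cvgrPdist_lt => _ /gt0_complexP[e e0 ->].
pose N : R := (n.+1 * n.+1)%:R.
have N0 : 0 < N by rewrite ltr0n muln_gt0.
have d0 : 0 < e / (2 * N) by rewrite divr_gt0 // mulr_gt0.
have : F [set X : normed_of M | forall ij, nrm (l ij - (X : M) ij.1 ij.2) < e / (2 * N)].
  by apply: filter_forall => ij; exact: hl.
apply: filterS => X /= hX.
rewrite normed_ofE -[cnorm _]/((mxnrm (L - X : M))%:C) ltcR.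
apply: le_lt_trans (mxnrm_le_entries _) _.
rewrite pair_bigA /=.
apply: (@le_lt_trans _ _ (\sum_(ij : 'I_n.+1 * 'I_n.+1) e / (2 * N))).
  by apply: ler_sum => ij _; rewrite !mxE -surjective_pairing ltW.
rewrite sumr_const card_prod !card_ord -[X in X < _]mulr_natr -/N.
have -> : e / (2 * N) * N = e / 2 by field; rewrite gt_eqF.
lra.
Qed.

HB.instance Definition _ := isCStarComplete.Build R M mxalg_cauchy_cvg.

End MatrixCStar.

(** * Completely positive maps *)

Section MatrixPositive.
Variable R : realType.
Implicit Types A C D : cstarAlgType R.

Lemma mx_positive_pos C n (X : 'M[C]_n.+1) : mx_positive X <-> pos (X : mxalg C n).
Proof. by split=> [[Y ->]|/posP[Y ->]]; [exact: (@star_mul_pos _ (mxalg C n)) | exists Y]. Qed.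

Lemma mx_positive0 C (X : 'M[C]_0) : mx_positive X.
Proof. by exists 0; apply/matrixP => -[]. Qed.

Lemma mx_positiveE C n (X : 'M[C]_n) : mx_positive X ->
  exists Y : 'M[C]_n, forall i j, X i j = \sum_t star (Y t i) * Y t j.
Proof.
move=> [Y ->]; exists Y => i j; rewrite mxE.
by apply: eq_bigr => t _; rewrite mxE.
Qed.

(* [mx_positive] asks for a square [Y]; here the number of rows is arbitrary, which
   amounts to positive matrices being closed under sums. *)
Lemma gram_positive C (T : finType) n (X : 'M[C]_n) (y : T -> 'I_n -> C) :
  (forall i j, X i j = \sum_t star (y t i) * y t j) -> mx_positive X.
Proof.
case: n X y => [|n] X y hX; first exact: mx_positive0.
apply/mx_positive_pos.
(* Each row [y t] becomes the first row of a square matrix that is zero elsewhere. *)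
pose Y t : mxalg C n := \matrix_(i, j) (if i == 0 then y t j else 0).
have -> : X = \sum_t star (Y t) * Y t :> mxalg C n.
  apply/matrixP => i j; rewrite hX.
  have -> : (\sum_t star (Y t) * Y t : mxalg C n) i j = \sum_t (star (Y t) * Y t : mxalg C n) i j.
    by rewrite [LHS]summxE.
  apply: eq_bigr => t _; rewrite [RHS]mxE (bigD1 0) //= big1 ?addr0.
    by rewrite !mxE.
  by move=> k /negbTE k0; rewrite !mxE k0 mulr0.
by apply: pos_sum => t _; exact: star_mul_pos.
Qed.

(** Applied entrywise, [phi] is again injective and compatible with the *-ring operations, so
    [pos_reflect] applies in the matrix algebras. The form of the hypotheses admits the non-unital
    inclusion of a corner. *)
Lemma mx_positive_reflect A D (phi : A -> D) n (X : 'M[A]_n) :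
  {morph phi : x y / x + y} -> {morph phi : x y / x * y} ->
  {morph phi : x / star x} -> injective phi ->
  mx_positive (map_mx phi X) -> mx_positive X.
Proof.
case: n X => [|n] X phiD phiM phiS phiI; first by move=> _; exact: mx_positive0.
have phi0 : phi 0 = 0 by apply: (@addrI _ (phi 0)); rewrite -phiD !addr0.
move/mx_positive_pos => h; apply/mx_positive_pos.
apply: (@pos_reflect R (mxalg A n) (mxalg D n) (fun Z => map_mx phi Z)) h.
- by move=> Z W; apply/matrixP => i j; rewrite !mxE phiD.
- move=> Z W; apply/matrixP => i j; rewrite !mxE (big_morph phi phiD phi0).
  by apply: eq_bigr => k _; rewrite phiM !mxE.
- by move=> Z; apply/matrixP => i j; rewrite !mxE phiS.
- by move=> Z W /matrixP h; apply/matrixP => i j; apply: phiI; have := h i j; rewrite !mxE.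
Qed.

End MatrixPositive.

Section UCP.
Variable R : realType.
Implicit Types A B C D I J : cstarAlgType R.

Definition completely_positive C D (f : C -> D) : Prop :=
  forall n (X : 'M[C]_n), mx_positive X -> mx_positive (map_mx f X).

Lemma ucpP C D (f : C -> D) : ucp f <->
  [/\ linear f, f 1 = 1 & completely_positive f].
Proof.
split=> [[_ fl f1 fp]|[fl f1 fp]]; split => //.
- by move=> c x y; apply: fl.
- by move=> n X pX; apply: fp.
- by move=> c x y _ _; apply: fl.
- by move=> n X _ pX; apply: fp.
Qed.

Lemma ucp_linear C D (f : C -> D) : ucp f -> linear f.
Proof. by case/ucpP. Qed.

Lemma ucp1 C D (f : C -> D) : ucp f -> f 1 = 1.
Proof. by case/ucpP. Qed.

Lemma ucp_cp C D (f : C -> D) : ucp f -> completely_positive f.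
Proof. by case/ucpP. Qed.

Lemma linD C D (f : C -> D) : linear f -> {morph f : x y / x + y}.
Proof. by move=> fl x y; have := fl 1 x y; rewrite !scale1r. Qed.

Lemma lin0 C D (f : C -> D) : linear f -> f 0 = 0.
Proof. by move=> fl; apply: (@addrI _ (f 0)); rewrite -(linD fl) !addr0. Qed.

Lemma linZ C D (f : C -> D) : linear f -> forall (c : R[i]) x, f (c *: x) = c *: f x.
Proof. by move=> fl c x; have := fl c x 0; rewrite (lin0 fl) !addr0. Qed.

Lemma linN C D (f : C -> D) : linear f -> {morph f : x / - x}.
Proof. by move=> fl x; rewrite -scaleN1r (linZ fl) scaleN1r. Qed.

Lemma linB C D (f : C -> D) : linear f -> {morph f : x y / x - y}.
Proof. by move=> fl x y; rewrite (linD fl) (linN fl). Qed.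

Lemma lin_sum C D (f : C -> D) (T : Type) (s : seq T) (P : pred T) (F : T -> C) :
  linear f -> f (\sum_(i <- s | P i) F i) = \sum_(i <- s | P i) f (F i).
Proof. by move=> fl; rewrite (big_morph f (linD fl) (lin0 fl)). Qed.

Lemma ucp_id C : ucp (@id C).
Proof. by apply/ucpP; split => // n X; rewrite map_mx_id. Qed.

Lemma ucp_comp C D I (g : D -> I) (f : C -> D) : ucp g -> ucp f -> ucp (g \o f).
Proof.
move=> /ucpP[gl g1 gp] /ucpP[fl f1 fp]; apply/ucpP; split => //.
- by move=> c x y /=; rewrite fl gl.
- by rewrite /= f1.
- by move=> n X /fp/gp; rewrite -map_mx_comp.
Qed.

Lemma ucp_pos C D (f : C -> D) a : ucp f -> pos a -> pos (f a).
Proof.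
move=> /ucp_cp fp /posP[b ->].
have : mx_positive (const_mx (star b * b) : 'M[C]_1).
  by apply: (@gram_positive _ _ 'I_1 _ _ (fun _ _ => b)) => i j; rewrite mxE big_ord1.
move/fp => /mx_positiveE[Y /(_ 0 0)]; rewrite !mxE => ->.
by rewrite big_ord1; exact: star_mul_pos.
Qed.

Lemma ucp_rsc C D (f : C -> D) r : ucp f -> f (rsc C r) = rsc D r.
Proof. by move=> uf; rewrite (linZ (ucp_linear uf)) (ucp1 uf). Qed.

Lemma ucp_sa C D (f : C -> D) a : ucp f -> star a = a -> star (f a) = f a.
Proof.
move=> uf sa_a; have fl := ucp_linear uf.
have -> : f a = f (rsc C (nrm a) + a) - rsc D (nrm a).
  by rewrite (linD fl) (ucp_rsc _ uf) addrC addKr.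
rewrite starB star_rsc (pos_sa (ucp_pos uf _)) //.
exact: sa_nrm_add.
Qed.

Lemma ucp_nrm_sa C D (f : C -> D) a : ucp f -> star a = a -> nrm (f a) <= nrm a.
Proof.
move=> uf sa_a; have fl := ucp_linear uf.
apply: sa_nrm_le; rewrite ?nrm_ge0 //; first exact: ucp_sa.
- by rewrite -(ucp_rsc _ uf) -(linB fl); apply: ucp_pos => //; apply: sa_nrm_sub.
- by rewrite -(ucp_rsc _ uf) -(linD fl); apply: ucp_pos => //; apply: sa_nrm_add.
Qed.

Lemma sa_re C (x : C) : star (x + star x) = x + star x.
Proof. by rewrite starD starK addrC. Qed.

Lemma sa_im C (x : C) : star ('i *: (x - star x)) = 'i *: (x - star x).
Proof. by rewrite scale_i_star starB starK -scalerN opprB. Qed.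

Lemma double_inj C : injective (fun x : C => x + x).
Proof.
move=> x y h; rewrite -(halfD x) -(halfD y) /half -!scalerDr.
by congr (_ *: _).
Qed.

Lemma scale_i_inj C : injective (fun x : C => 'i *: x).
Proof.
move=> x y h; have := congr1 ( *:%R (- 'i)) h.
by rewrite !scalerA mulNr -expr2 sqrCi opprK !scale1r.
Qed.

Lemma lin_eq_sa C D (f g : C -> D) : linear f -> linear g ->
  (forall x, star x = x -> f x = g x) -> f = g.
Proof.
move=> fl gl fg; apply/funext => x; apply: double_inj.
have h1 := fg _ (sa_re x); have h2 := fg _ (sa_im x).
rewrite (linD fl) (linD gl) in h1; rewrite (linZ fl) (linZ gl) (linB fl) (linB gl) in h2.
move/scale_i_inj: h2 => h2.
transitivity ((f x + f (star x)) + (f x - f (star x))); first by ncring.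
by rewrite h1 h2; ncring.
Qed.

Lemma ucp_star C D (f : C -> D) : ucp f -> {morph f : x / star x}.
Proof.
move=> uf x; have fl := ucp_linear uf.
have h1 := ucp_sa uf (sa_re x); have h2 := ucp_sa uf (sa_im x).
rewrite (linD fl) starD in h1; rewrite (linZ fl) (linB fl) scale_i_star starB -scalerN in h2.
move/scale_i_inj: h2; rewrite opprB => h2; apply: double_inj.
transitivity ((f x + f (star x)) - (f x - f (star x))); first by ncring.
by rewrite -h1 -h2; ncring.
Qed.

(* In the Gram matrix [Y^* Y] of [Psi (z_i^* z_j)], for z = (1, a^*, b), the column
   [Y_1 - Y_0 k(a^* )] has norm zero. *)
Lemma pseudo_expectation_mull A B I (f : cstar_inclusion A B) (k : cstar_inclusion A I)
    (Psi : B -> I) : pseudo_expectation f k Psi ->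
  forall a b, Psi (f a * b) = k a * Psi b.
Proof.
move=> [uP fk] a b.
pose z (i : 'I_3) : B := match val i with 0 => 1 | 1 => f (star a) | _ => b end.
pose X : 'M[B]_3 := \matrix_(i, j) (star (z i) * z j).
have pX : mx_positive X.
  by apply: (@gram_positive _ _ 'I_1 _ _ (fun _ => z)) => i j; rewrite mxE big_ord1.
have [Y hY] := mx_positiveE (ucp_cp uP pX).
pose i0 : 'I_3 := ord0; pose i1 : 'I_3 := @Ordinal 3 1 isT; pose i2 : 'I_3 := @Ordinal 3 2 isT.
have S i j : \sum_t star (Y t i) * Y t j = Psi (star (z i) * z j).
  by rewrite -hY !mxE.
pose u t := Y t i1 - Y t i0 * k (star a).
have suu : \sum_t star (u t) * u t = 0.
  transitivity (\sum_t star (Y t i1) * Y t i1 - (\sum_t star (Y t i1) * Y t i0) * k (star a)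
    - star (k (star a)) * (\sum_t star (Y t i0) * Y t i1)
    + star (k (star a)) * (\sum_t star (Y t i0) * Y t i0) * k (star a)).
    rewrite -mulrA !mulr_suml !mulr_sumr -!sumrB -big_split; apply: eq_bigr => t _.
    by rewrite /u starB starM; ncring.
  rewrite !S /z /= star1 !mulr1 !mul1r (ucp1 uP) -!cincl_star -rmorphM !fk !starK.
  by rewrite rmorphM mulr1; ncring.
have u0 t : u t = 0.
  apply: star_mul0; apply: (pos_sum_eq0 (F := fun t => star (u t) * u t)) => // s.
  exact: star_mul_pos.
have : \sum_t star (Y t i1) * Y t i2 = k a * \sum_t star (Y t i0) * Y t i2.
  rewrite mulr_sumr; apply: eq_bigr => t _.
  have /eqP := u0 t; rewrite subr_eq0 => /eqP ->.
  by rewrite starM -cincl_star starK mulrA.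
by rewrite !S /z /= -cincl_star starK star1 mul1r.
Qed.

Lemma pseudo_expectation_mulr A B I (f : cstar_inclusion A B) (k : cstar_inclusion A I)
    (Psi : B -> I) : pseudo_expectation f k Psi ->
  forall a b, Psi (b * f a) = Psi b * k a.
Proof.
move=> pP a b; have uP := pP.1; apply: (can_inj (@starK _ _)).
by rewrite -(ucp_star uP) !starM -!cincl_star (pseudo_expectation_mull pP) (ucp_star uP).
Qed.

Lemma ucp_cincl A B (k : cstar_inclusion A B) : ucp k.
Proof.
apply/ucpP; split; [exact: linearP | exact: rmorph1 |].
move=> n X [Y ->]; exists (map_mx k Y); apply/matrixP => i j.
rewrite !mxE rmorph_sum; apply: eq_bigr => t _.
by rewrite !mxE -cincl_star -rmorphM.
Qed.

Lemma operator_systemT C : operator_system [set: C].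
Proof. by []. Qed.

(** The map to extend is [f] after the inverse of [k], on the operator system [range k]. It is
    completely positive because [k] reflects positivity: a matrix over [range k] that is positive
    over [D] comes from a positive one over [C]. *)
Lemma injective_extension C D J (k : cstar_inclusion C D) (f : C -> J) :
  injective_system [set: J] -> ucp f ->
  exists2 g : D -> J, ucp g & forall x, g (k x) = f x.
Proof.
move=> [_ injJ] /ucpP[fl f1 fp].
pose h (d : D) : C := xget 0 [set c | k c = d].
have hK c : h (k c) = c.
  by apply: (@cincl_inj _ _ _ k); apply: (xgetPex 0 (P := [set c' | k c' = k c])); exists c.
have osS : operator_system (range k).
  split; first by exists 1 => //; rewrite rmorph1.
    by move=> c _ _ [x _ <-] [y _ <-]; exists (c *: x + y) => //; rewrite linearP.
  by move=> _ [x _ <-]; exists (star x) => //; rewrite cincl_star.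
have uS : ucp_on (range k) [set: J] (f \o h).
  split => //.
  - by move=> c _ _ [x _ <-] [y _ <-] /=; rewrite -linearP !hK fl.
  - by rewrite /= -(rmorph1 k) hK.
  - move=> n X SX pX; rewrite map_mx_comp; apply: fp.
    apply: (@mx_positive_reflect _ _ _ k) => //; [exact: rmorphD | exact: rmorphM
      | exact: cincl_star | exact: cincl_inj |].
    have -> : map_mx k (map_mx h X) = X => //.
    apply/matrixP => i j; rewrite !mxE; have [x _ <-] := SX i j.
    by rewrite hK.
have [g ug gf] := injJ D _ _ _ osS (operator_systemT D) (@subsetT _ _) uS.
by exists g => // x; rewrite gf /= ?hK //; exists x.
Qed.

End UCP.

(** * Bounded nets *)

Section BoundedNets.
Variables (R : realType) (L : Type) (l0 : L) (I : cstarAlgType R).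

Definition bounded_net : pred (L -> I) :=
  fun x => `[< exists M : R, forall l, nrm (x l) <= M >].

(* The phantom parameter [l] witnesses that L is nonempty, so that the algebra is
   nontrivial. *)
Record bounded_nets (l : L) := Linf {
  linf_val :> L -> I;
  linf_valP : bounded_net linf_val
}.

Local Notation linf := (bounded_nets l0).

HB.instance Definition _ := [isSub of linf for @linf_val l0].
HB.instance Definition _ := [Choice of linf by <:].

Lemma linfP (x : linf) : exists M : R, forall l, nrm (x l) <= M.
Proof. by case: x => x /= /asboolP. Qed.

Lemma linf_eqP (x y : linf) : (forall l, x l = y l) -> x = y.
Proof. by move=> h; apply/val_inj/funext. Qed.

Lemma bounded_net_submod : submod_closed bounded_net.
Proof.
split; first by apply/asboolP; exists 0 => l; rewrite nrm0.
move=> c x y /asboolP[M hM] /asboolP[N hN]; apply/asboolP.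
exists (Normc.normc c * M + N) => l; apply: le_trans (nrmD _ _) _.
apply: lerD => //; rewrite nrmZ ler_wpM2l //.
by case: c => a b; exact: sqrtr_ge0.
Qed.

HB.instance Definition _ :=
  GRing.SubChoice_isSubLmodule.Build R[i] (L -> I) bounded_net linf bounded_net_submod.

Lemma linfDE (x y : linf) l : (x + y) l = x l + y l. Proof. by []. Qed.
Lemma linfBE (x y : linf) l : (x - y) l = x l - y l. Proof. by []. Qed.
Lemma linfZE (c : R[i]) (x : linf) l : (c *: x) l = c *: x l. Proof. by []. Qed.
Lemma linf0E l : (0 : linf) l = 0. Proof. by []. Qed.

Lemma linf1_subproof : bounded_net (fun=> 1).
Proof. by apply/asboolP; exists 1 => l; rewrite nrm1. Qed.

Lemma linfM_subproof (x y : linf) : bounded_net (fun l => x l * y l).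
Proof.
have [[M hM] [N hN]] := (linfP x, linfP y).
apply/asboolP; exists (M * N) => l; apply: le_trans (nrmM _ _) _.
by apply: ler_pM; rewrite ?nrm_ge0.
Qed.

Lemma linf_star_subproof (x : linf) : bounded_net (fun l => star (x l)).
Proof. by have [M hM] := linfP x; apply/asboolP; exists M => l; rewrite nrm_star. Qed.

Definition linf1 : linf := Linf l0 linf1_subproof.
Definition linfM (x y : linf) : linf := Linf l0 (linfM_subproof x y).
Definition linf_star (x : linf) : linf := Linf l0 (linf_star_subproof x).

Lemma linfMA : associative linfM.
Proof. by move=> x y z; apply: linf_eqP => l /=; rewrite mulrA. Qed.
Lemma linf_mul1 : left_id linf1 linfM.
Proof. by move=> x; apply: linf_eqP => l /=; rewrite mul1r. Qed.
Lemma linf_mulr1 : right_id linf1 linfM.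
Proof. by move=> x; apply: linf_eqP => l /=; rewrite mulr1. Qed.
Lemma linfDl : left_distributive linfM +%R.
Proof. by move=> x y z; apply: linf_eqP => l /=; rewrite mulrDl. Qed.
Lemma linfDr : right_distributive linfM +%R.
Proof. by move=> x y z; apply: linf_eqP => l /=; rewrite mulrDr. Qed.
Lemma linf1_neq0 : linf1 != 0.
Proof.
apply/eqP => h; have /eqP : (1 : I) = 0 by exact: (congr1 (fun x : linf => x l0) h).
by rewrite oner_eq0.
Qed.

HB.instance Definition _ := GRing.Zmodule_isNzRing.Build linf
  linfMA linf_mul1 linf_mulr1 linfDl linfDr linf1_neq0.

Lemma linfME (x y : linf) l : (x * y) l = x l * y l. Proof. by []. Qed.

Lemma linf_scaleAl (c : R[i]) (x y : linf) : c *: (x * y) = c *: x * y.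
Proof. by apply: linf_eqP => l; rewrite !(linfZE, linfME) scalerAl. Qed.
Lemma linf_scaleAr (c : R[i]) (x y : linf) : c *: (x * y) = x * (c *: y).
Proof. by apply: linf_eqP => l; rewrite !(linfZE, linfME) scalerAr. Qed.

HB.instance Definition _ := GRing.Lmodule_isLalgebra.Build R[i] linf linf_scaleAl.
HB.instance Definition _ := GRing.Lalgebra_isAlgebra.Build R[i] linf linf_scaleAr.

Definition linf_nrm (x : linf) : R := sup (range (fun l => nrm (x l))).

Lemma linf_has_sup (x : linf) : has_sup (range (fun l => nrm (x l))).
Proof.
split; first by exists (nrm (x l0)), l0.
by have [M hM] := linfP x; exists M => _ [l _ <-].
Qed.

Lemma linf_nrm_ub (x : linf) l : nrm (x l) <= linf_nrm x.
Proof. by apply: sup_upper_bound; [exact: linf_has_sup | exists l]. Qed.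

Lemma linf_nrm_le (x : linf) M : (forall l, nrm (x l) <= M) -> linf_nrm x <= M.
Proof.
move=> h; apply: ge_sup; first by exists (nrm (x l0)), l0.
by move=> _ [l _ <-].
Qed.

Lemma linf_nrm_ge0 (x : linf) : 0 <= linf_nrm x.
Proof. exact: le_trans (nrm_ge0 (x l0)) (linf_nrm_ub x l0). Qed.

Definition linf_cnorm (x : linf) : R[i] := (linf_nrm x)%:C.

Lemma linf_starK : involutive linf_star.
Proof. by move=> x; apply: linf_eqP => l /=; rewrite starK. Qed.
Lemma linf_starD : {morph linf_star : x y / x + y}.
Proof. by move=> x y; apply: linf_eqP => l /=; rewrite starD. Qed.
Lemma linf_starZ (c : R[i]) (x : linf) : linf_star (c *: x) = c^*%R *: linf_star x.
Proof. by apply: linf_eqP => l; exact: starZ. Qed.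
Lemma linf_starM (x y : linf) : linf_star (x * y) = linf_star y * linf_star x.
Proof. by apply: linf_eqP => l; exact: starM. Qed.

Lemma linf_normD (x y : linf) : linf_cnorm (x + y) <= linf_cnorm x + linf_cnorm y.
Proof.
rewrite /linf_cnorm -rmorphD lecR; apply: linf_nrm_le => l.
by apply: le_trans (nrmD _ _) _; apply: lerD; exact: linf_nrm_ub.
Qed.

Lemma linf_normZ_le (c : R[i]) (x : linf) :
  linf_nrm (c *: x) <= Normc.normc c * linf_nrm x.
Proof.
apply: linf_nrm_le => l; rewrite linfZE nrmZ ler_wpM2l ?linf_nrm_ub //.
by case: c => a b; exact: sqrtr_ge0.
Qed.

Lemma linf_normZ (c : R[i]) (x : linf) : linf_cnorm (c *: x) = `|c| * linf_cnorm x.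
Proof.
rewrite /linf_cnorm normc_def -rmorphM; congr (_%:C).
have -> : Num.sqrt (complex.Re c ^+ 2 + complex.Im c ^+ 2) = Normc.normc c by case: c.
apply/le_anti/andP; split; first exact: linf_normZ_le.
have [->|c0] := eqVneq c 0; first by rewrite Normc.normc0 mul0r linf_nrm_ge0.
have n0 : 0 < Normc.normc c.
  rewrite lt_def; apply/andP; split; last by case: c {c0} => a b; exact: sqrtr_ge0.
  by apply: contra c0 => /eqP /Normc.eq0_normc ->.
have := linf_normZ_le c^-1 (c *: x).
by rewrite scalerA mulVf // scale1r Normc.normcV mulrC ler_pdivlMr // mulrC.
Qed.

Lemma linf_norm0_eq0 (x : linf) : linf_cnorm x = 0 -> x = 0.
Proof.
move/(@complexI R) => x0; apply: linf_eqP => l; rewrite linf0E.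
by apply: nrm0_eq0; apply/le_anti; rewrite nrm_ge0 -x0 linf_nrm_ub.
Qed.

Lemma linf_normM (x y : linf) : linf_cnorm (x * y) <= linf_cnorm x * linf_cnorm y.
Proof.
rewrite /linf_cnorm -rmorphM lecR; apply: linf_nrm_le => l.
by apply: le_trans (nrmM _ _) _; apply: ler_pM; rewrite ?nrm_ge0 ?linf_nrm_ub.
Qed.

Lemma linf_norm_starM (x : linf) : linf_cnorm (linf_star x * x) = linf_cnorm x ^+ 2.
Proof.
rewrite /linf_cnorm -rmorphXn; congr (_%:C); apply/le_anti/andP; split.
  apply: linf_nrm_le => l; rewrite linfME nrm_starM.
  by rewrite ler_sqr ?nnegrE ?nrm_ge0 ?linf_nrm_ge0 ?linf_nrm_ub.
set m := linf_nrm (linf_star x * x).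
have m0 : 0 <= m by exact: linf_nrm_ge0.
rewrite -(sqr_sqrtr m0) ler_sqr ?nnegrE ?linf_nrm_ge0 ?sqrtr_ge0 //.
apply: linf_nrm_le => l.
rewrite -ler_sqr ?nnegrE ?nrm_ge0 ?sqrtr_ge0 // sqr_sqrtr // -nrm_starM.
exact: (linf_nrm_ub (linf_star x * x) l).
Qed.

HB.instance Definition _ := isPreCStarAlgebra.Build R linf
  linf_starK linf_starD linf_starZ linf_starM linf_normD
  linf_normZ linf_norm0_eq0 linf_normM linf_norm_starM.

Lemma linf_starE (x : linf) l : (star x) l = star (x l). Proof. by []. Qed.
Lemma linf_cnormE (x : linf) : cnorm x = (linf_nrm x)%:C. Proof. by []. Qed.

Lemma linf_cauchy_cvg (F : set_system (normed_of linf)) :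
  ProperFilter F -> cauchy F -> cvg F.
Proof.
move=> FF cF.
have h l : exists a : I,
    forall e : R, 0 < e -> F [set x : normed_of linf | nrm (a - (x : linf) l) < e].
  apply: (@cauchy_coord_cvg R linf I (fun x => x l)) => // x y.
  by rewrite cnormE linf_cnormE lecR (linf_nrm_ub (x - y) l).
have [a ha] := choice h.
(* Convergence to the pointwise limit is uniform: the ball around [x] belongs to [F], so for each
   [l] it contains some [y] with [y l] close to [a l]. *)
have close (e : R) : 0 < e ->
    exists2 x : linf, F (ball (x : normed_of linf) e%:C) & forall l, nrm (a l - x l) <= e.
  move=> e0.
  have e0C : 0 < e%:C :> R[i] by rewrite ltcR.
  have /cauchyP/(_ _ e0C)[x Fx] := cF.
  exists x => // l; apply/ler_addgt0Pr => d d0.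
  have [y [/= h1 h2]] := filter_ex (filterI (ha l d d0) Fx).
  move: h2; rewrite -ball_normE /= normed_ofE linf_cnormE ltcR => h2.
  have h3 : nrm (x l - (y : linf) l) < e.
    exact: le_lt_trans (linf_nrm_ub ((x : linf) - (y : linf)) l) h2.
  have -> : a l - x l = (a l - (y : linf) l) - (x l - (y : linf) l) by ncring.
  by apply: le_trans (nrmB _ _) _; lra.
have aP : bounded_net a.
  have [x _ hx] := close 1 ltr01; have [M hM] := linfP x.
  apply/asboolP; exists (1 + M) => l.
  have -> : a l = (a l - x l) + x l by ncring.
  by apply: le_trans (nrmD _ _) _; apply: lerD.
apply/cvg_ex; exists (Linf l0 aP : normed_of linf).
apply/cvgrPdist_lt => _ /gt0_complexP[e e0 ->].
have e3 : 0 < e / 3 by rewrite divr_gt0.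
have [x Fx hx] := close _ e3.
apply: filterS Fx => y /=.
rewrite -ball_normE /= !normed_ofE !linf_cnormE !ltcR => hy.
apply: (@le_lt_trans _ _ (e / 3 + e / 3)); last by lra.
apply: linf_nrm_le => l.
have -> : (Linf l0 aP - (y : linf)) l = (a l - x l) + (x l - (y : linf) l).
  by rewrite linfBE /=; ncring.
apply: le_trans (nrmD _ _) _; apply: lerD => //.
exact: le_trans (linf_nrm_ub ((x : linf) - (y : linf)) l) (ltW hy).
Qed.

HB.instance Definition _ := isCStarComplete.Build R linf linf_cauchy_cvg.

End BoundedNets.

(** * Rigidity of the injective envelope *)

Section CompletelyPositiveMaps.
Variable R : realType.
Implicit Types C D : cstarAlgType R.

Lemma mx_positive_sum C (T : finType) n (X : T -> 'M[C]_n) :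
  (forall t, mx_positive (X t)) -> mx_positive (\sum_t X t).
Proof.
move=> pX; have [Y hY] := choice (fun t => mx_positiveE (pX t)).
apply: (@gram_positive _ _ (T * 'I_n)%type _ _ (fun s => Y s.1 s.2)) => i j.
rewrite summxE -(pair_bigA _ (fun t s => star (Y t s i) * Y t s j)) /=.
by apply: eq_bigr => t _; rewrite hY.
Qed.

Lemma mx_positiveZ C n (r : R) (X : 'M[C]_n) : 0 <= r ->
  mx_positive X -> mx_positive (scale_mx r%:C X).
Proof.
move=> r0 /mx_positiveE[Y hY].
pose q := Num.sqrt r.
apply: (@gram_positive _ _ 'I_n _ _ (fun t i => q%:C *: Y t i)) => i j.
rewrite scale_mxE hY scaler_sumr; apply: eq_bigr => t _.
by rewrite starZr -scalerAl -scalerAr scalerA -rmorphM -expr2 sqr_sqrtr.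
Qed.

(** Contractivity on the two selfadjoint parts costs the factor 2. The purpose is a bound uniform in
    [f], which makes the nets [s |-> s x] bounded. *)
Lemma ucp_nrm_le2 C D (f : C -> D) x : ucp f -> nrm (f x) <= 2 * nrm x.
Proof.
move=> uf; have fl := ucp_linear uf.
have n2 (E : cstarAlgType R) (y : E) : nrm (y + y) = 2 * nrm y.
  have -> : y + y = 2%:C *: y by rewrite rmorphD rmorph1 scalerDl scale1r.
  by rewrite nrmZr ger0_norm.
have ni (E : cstarAlgType R) (z : E) : nrm ('i *: z) = nrm z.
  by rewrite nrmZ -[X in Normc.normc X]complexiE /= expr0n expr1n add0r sqrtr1 mul1r.
have h1 := ucp_nrm_sa uf (sa_re x); have h2 := ucp_nrm_sa uf (sa_im x).
rewrite (linZ fl) !ni (linB fl) in h2; rewrite (linD fl) in h1.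
have := nrmD (f x + f (star x)) (f x - f (star x)).
have -> : (f x + f (star x)) + (f x - f (star x)) = f x + f x by ncring.
rewrite n2.
have := nrmD x (star x); have := nrmB x (star x); rewrite nrm_star.
by lra.
Qed.

Lemma ucp_iter C (f : C -> C) n : ucp f -> ucp (iter n f).
Proof.
by move=> uf; elim: n => [|n IH]; [exact: ucp_id | exact: (ucp_comp uf IH)].
Qed.

(** The mean starts at [f] and not at the identity, so that on selfadjoint [x] its norm is at most
    [nrm (f x)]. *)
Definition cesaro C (f : C -> C) n (x : C) : C :=
  (n.+1%:R^-1)%:C *: \sum_(i < n.+1) iter i.+1 f x.

Lemma mean_const C (x : C) n : (n.+1%:R^-1)%:C *: (x *+ n.+1) = x.
Proof.
rewrite -[X in _ *: X]scaler_nat scalerA -(rmorph_nat (real_complex R)) -rmorphM.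
by rewrite mulVf ?pnatr_eq0 // rmorph1 scale1r.
Qed.

Lemma ucp_cesaro C (f : C -> C) n : ucp f -> ucp (cesaro f n).
Proof.
move=> uf; have ui i := ucp_iter i uf; apply/ucpP; split.
- move=> c x y; rewrite /cesaro scalerA mulrC -scalerA -scalerDr; congr (_ *: _).
  rewrite scaler_sumr -big_split; apply: eq_bigr => i _.
  exact: (ucp_linear (ui i.+1)).
- rewrite /cesaro (eq_bigr (fun=> 1)) => [|i _]; last exact: (ucp1 (ui i.+1)).
  by rewrite sumr_const card_ord mean_const.
- move=> m X pX.
  have -> : map_mx (cesaro f n) X =
      scale_mx (n.+1%:R^-1)%:C (\sum_(i < n.+1) map_mx (iter i.+1 f) X).
    apply/matrixP => i j; rewrite scale_mxE !mxE summxE.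
    by congr (_ *: _); apply: eq_bigr => t _; rewrite mxE.
  apply: mx_positiveZ; first by rewrite invr_ge0.
  by apply: mx_positive_sum => i; exact: (ucp_cp (ui i.+1)).
Qed.

End CompletelyPositiveMaps.

Section Rigidity.
Variables (R : realType) (A I : cstarAlgType R) (k : cstar_inclusion A I).

Local Notation U := {phi : I -> I | pseudo_expectation k k phi}.

Let app (s : U) : I -> I := sval s.

Let ucp_app (s : U) : ucp (app s). Proof. by case: s => phi []. Qed.

Let app_k (s : U) a : app s (k a) = k a. Proof. by case: s => phi []. Qed.

(** Hamana's preorder, restricted to selfadjoint elements, where ucp maps are known to be
    contractive. [shrink s t] puts [t] below [s], so the maximal elements that Zorn's lemma yields
    are the minimal maps. *)
Definition shrink : rel U :=
  fun s t => `[< forall x, star x = x -> nrm (app t x) <= nrm (app s x) >].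

Lemma shrink_refl s : shrink s s. Proof. by apply/asboolP. Qed.

Lemma shrink_trans r s t : shrink r s -> shrink s t -> shrink r t.
Proof.
move=> /asboolP rs /asboolP st; apply/asboolP => x sx.
exact: le_trans (st x sx) (rs x sx).
Qed.

Lemma pseudo_id : pseudo_expectation k k id.
Proof. by split; [exact: ucp_id | ]. Qed.

Definition pid : U := exist _ id pseudo_id.

Section ChainBound.
Variables (Ch : set U) (chT : total_on Ch (fun s t => shrink s t)) (s0 : U) (Chs0 : Ch s0).
Hypothesis injI : injective_system [set: I].

Let L := {s : U | Ch s}.
Let l0 : L := exist _ s0 Chs0.
Let below (l l' : L) := shrink (sval l) (sval l').

Local Notation N := (bounded_nets I l0).

Let below_total (l l' : L) : below l l' || below l' l.
Proof.
by case: l l' => [s hs] [t ht]; have [|] := chT hs ht; rewrite /below /= => ->; rewrite ?orbT.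
Qed.

(** A matrix of eventually constant nets has finitely many entries, so one index makes them all
    constant; positivity of the matrix of eventual values is read off there. *)
Let below_directed (T : finType) (g : T -> L) : exists l, forall t, below (g t) l.
Proof.
suff [l hl] : exists l, forall t, t \in enum T -> below (g t) l.
  by exists l => t; apply: hl; rewrite mem_enum.
elim: (enum T) => [|t s [l hl]]; first by exists l0.
have [h|h] := orP (below_total (g t) l).
  by exists l => u; rewrite in_cons => /orP[/eqP ->|/hl].
exists (g t) => u; rewrite in_cons => /orP[/eqP ->|/hl]; first exact: shrink_refl.
by move=> /shrink_trans; apply.
Qed.

Let evset (x : N) : set I := [set z | exists l, forall l', below l l' -> x l' = z].

(** The limit along the chain of an eventually constant net, with default 0 for other nets. Totality
    of the chain makes the eventual value unique. *)
Let ev (x : N) : I := xget 0 (evset x).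

Let evE (x : N) l z : (forall l', below l l' -> x l' = z) -> ev x = z.
Proof.
move=> h; have : evset x (ev x) by apply: (xgetPex 0); exists z, l.
move=> [l1 h1]; have [b|b] := orP (below_total l l1).
  by rewrite -(h _ b) (h1 l1) //; exact: shrink_refl.
by rewrite -(h1 _ b) (h l) //; exact: shrink_refl.
Qed.

Let S : set N := [set x | exists z, evset x z].

Let S_system : operator_system S.
Proof.
split.
- by exists 1, l0.
- move=> c x y [z [l hl]] [w [m hm]]; exists (c *: z + w).
  have [h|h] := orP (below_total l m); [exists m | exists l] => l' hl'.
    by rewrite linfDE linfZE (hl l') ?(hm l') //; apply: shrink_trans h hl'.
  by rewrite linfDE linfZE (hl l') ?(hm l') //; apply: shrink_trans h hl'.
- by move=> x [z [l hl]]; exists (star z), l => l' hl'; rewrite linf_starE hl.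
Qed.

Let net_sum (T : finType) (F : T -> N) l : (\sum_t F t) l = \sum_t F t l.
Proof. by rewrite (big_morph (fun x : N => x l) (fun x y => linfDE x y l) (linf0E l0 I l)). Qed.

Let ev_ucp : ucp_on S [set: I] ev.
Proof.
split => //.
- move=> c x y [z [l hl]] [w [m hm]]; rewrite (evE hl) (evE hm).
  have [h|h] := orP (below_total l m); [apply: (@evE _ m) | apply: (@evE _ l)] => l' hl'.
    by rewrite linfDE linfZE (hl l') ?(hm l') //; apply: shrink_trans h hl'.
  by rewrite linfDE linfZE (hl l') ?(hm l') //; apply: shrink_trans h hl'.
- by apply: (@evE _ l0).
- move=> n X SX /mx_positiveE[Y hY].
  have [z hz] := choice (fun ij : 'I_n * 'I_n => SX ij.1 ij.2).
  have [g hg] := choice hz.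
  have [l hl] := below_directed g.
  apply: (@gram_positive _ _ 'I_n _ _ (fun t i => Y t i l)) => i j.
  rewrite mxE (evE (hg (i, j))) -(hg (i, j) l) //= hY net_sum.
  by apply: eq_bigr => t _.
Qed.

Let net_subproof x : bounded_net (fun l : L => app (sval l) x).
Proof.
apply/asboolP; exists (2 * nrm x) => l.
exact: ucp_nrm_le2 (ucp_app _).
Qed.

Let net x : N := Linf l0 (net_subproof x).

(** Gram factors are chosen separately at each index. They form bounded nets, since [|Y_ti|^2] is
    dominated by the diagonal entry [s (X i i)]. *)
Let net_cp : completely_positive net.
Proof.
move=> n X pX.
have [Y hY] := choice (fun l : L => mx_positiveE (ucp_cp (ucp_app (sval l)) pX)).
have Yb t i : bounded_net (fun l => Y l t i).
  apply/asboolP; exists (1 + 2 * nrm (X i i)) => l.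
  have h : nrm (Y l t i) ^+ 2 <= 2 * nrm (X i i).
    apply: le_trans (ucp_nrm_le2 (X i i) (ucp_app (sval l))).
    rewrite -nrm_starM; apply: pos_nrm_mono; first exact: star_mul_pos.
    have := hY l i i; rewrite mxE => ->.
    rewrite (bigD1 t) //= addrC addrK.
    by apply: pos_sum => j _; exact: star_mul_pos.
  by have := nrm_ge0 (Y l t i); nra.
apply: (@gram_positive _ _ 'I_n _ _ (fun t i => Linf l0 (Yb t i))) => i j.
apply: linf_eqP => l; rewrite mxE net_sum /=.
by have := hY l i j; rewrite mxE.
Qed.

(* [psi] extends to all bounded nets the eventual value of the eventually constant ones.
   It kills the nets that are eventually 0, so [psi] of the net [s |-> s x] depends on
   its tails only. *)
Lemma chain_bound : exists t, forall s, Ch s -> shrink s t.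
Proof.
have [psi upsi psiev] := injI.2 N S setT ev S_system (operator_systemT _) (@subsetT _ _) ev_ucp.
have psi_ucp : ucp psi by [].
pose Phi x := psi (net x).
have netl (c : R[i]) x y : net (c *: x + y) = c *: net x + net y.
  by apply: linf_eqP => l; exact: (ucp_linear (ucp_app (sval l))).
have Phi_pe : pseudo_expectation k k Phi.
  split.
    apply/ucpP; split.
    - by move=> c x y; rewrite /Phi netl (ucp_linear psi_ucp).
    - rewrite /Phi (_ : net 1 = 1) ?(ucp1 psi_ucp) //.
      by apply: linf_eqP => l; exact: (ucp1 (ucp_app (sval l))).
    - move=> n X /net_cp/(ucp_cp psi_ucp).
      by rewrite -map_mx_comp.
  move=> a; have ea : evset (net (k a)) (k a) by exists l0 => l' _; exact: app_k.
  rewrite /Phi psiev; last by exists (k a).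
  by have [l hl] := ea; apply: evE hl.
exists (exist _ Phi Phi_pe) => s Chs; apply/asboolP => x sx; rewrite /app /=.
pose ls : L := exist _ s Chs.
(* The net of [x] with its values replaced by 0 at the indices not below [s]: [psi] sends both nets
   to the same element, and the norm of this one is at most [nrm (s x)]. *)
have yP : bounded_net (fun l : L => if below ls l then app (sval l) x else 0).
  apply/asboolP; exists (2 * nrm x) => l; case: ifP => _.
    exact: ucp_nrm_le2 (ucp_app _).
  by rewrite nrm0 mulr_ge0 ?nrm_ge0.
pose y : N := Linf l0 yP.
have e0 : evset (net x - y) 0.
  by exists ls => l' h; rewrite linfBE /= h subrr.
have : psi (net x - y) = 0.
  rewrite psiev; last by exists 0.
  by have [l hl] := e0; apply: evE hl.
rewrite (linB (ucp_linear psi_ucp)) => /eqP; rewrite subr_eq0 => /eqP h.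
rewrite /Phi h; apply: le_trans (ucp_nrm_sa psi_ucp _) _.
  apply: linf_eqP => l; rewrite linf_starE /=; case: ifP => _; last exact: star0.
  exact: ucp_sa (ucp_app _) sx.
rewrite -[nrm y]/(linf_nrm y); apply: linf_nrm_le => l /=.
case: ifP => [/asboolP/(_ x sx)//|_]; by rewrite nrm0 nrm_ge0.
Qed.

End ChainBound.

Definition minimal (s : U) := forall t, shrink s t -> shrink t s.

(* If [s] is minimal, then [s x] is no larger than any Cesaro mean of the [s^i x]; these
   means tend to 0 at [x - s x]. *)
Lemma minimal_idempotent s : minimal s -> forall x, app s (app s x) = app s x.
Proof.
move=> ms; pose f := app s; have uf : ucp f := ucp_app s; have fl := ucp_linear uf.
suff : f \o f = f by move=> h x; exact: (congr1 (fun g => g x) h).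
apply: lin_eq_sa => //; first exact: ucp_linear (ucp_comp uf uf).
move=> x sx /=; apply/esym/eqP; rewrite -subr_eq0; apply/eqP/nrm_eq0_small => e e0.
have fixi n a : iter n f (k a) = k a by elim: n => //= n ->; exact: app_k.
have key n : nrm (f x - f (f x)) <= 2 * nrm x / n.+1%:R.
  have cpe : pseudo_expectation k k (cesaro f n).
    split; first exact: ucp_cesaro.
    move=> a; rewrite /cesaro (eq_bigr (fun=> k a)) => [|i _]; last exact: fixi.
    by rewrite sumr_const card_ord mean_const.
  have n0 : 0 < n.+1%:R :> R by rewrite ltr0n.
  have /ms/asboolP : shrink s (exist _ (cesaro f n) cpe).
    apply/asboolP => z sz; rewrite /app /= /cesaro nrmZr gtr0_norm ?invr_gt0 //.
    rewrite mulrC ler_pdivrMr //; apply: le_trans (nrm_sum _ _ _) _.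
    apply: (@le_trans _ _ (\sum_(i < n.+1) nrm (f z))).
      apply: ler_sum => i _; rewrite iterSr; apply: ucp_nrm_sa (ucp_iter _ uf) _.
      exact: ucp_sa.
    by rewrite sumr_const card_ord -[leLHS]mulr_natr.
  have sfx : star (f x) = f x by exact: ucp_sa.
  move=> /(_ (x - f x)); rewrite starB sx sfx => /(_ erefl).
  rewrite /app /= -/(app s) -/f (linB fl) => /le_trans; apply.
  rewrite /cesaro.
  have -> : \sum_(i < n.+1) iter i.+1 f (x - f x) = f x - iter n.+2 f x.
    rewrite -(big_mkord xpredT (fun i => iter i.+1 f (x - f x))).
    rewrite (eq_bigr (fun i => - (iter i.+2 f x - iter i.+1 f x))) => [|i _].
      by rewrite sumrN telescope_sumr // opprB.
    by rewrite (linB (ucp_linear (ucp_iter i.+1 uf))) -iterSr opprB.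
  rewrite nrmZr gtr0_norm ?invr_gt0 // mulrC ler_pM2r ?invr_gt0 //.
  apply: le_trans (nrmB _ _) _.
  have := ucp_nrm_sa uf sx; have := ucp_nrm_sa (ucp_iter n.+2 uf) sx; lra.
pose M := 2 * nrm x / e.
have M0 : 0 <= M by rewrite divr_ge0 ?mulr_ge0 ?nrm_ge0 // ltW.
apply: le_trans (key (Num.bound M)) _.
rewrite ler_pdivrMr ?ltr0n // -ler_pdivrMl // mulrC -/M.
by apply: le_trans (ltW (archi_boundP M0)) _; rewrite ler_nat.
Qed.

(** A map into the range is first extended with values in [I], then composed with [f], which fixes
    its range. *)
Lemma idempotent_range_injective (f : I -> I) : injective_system [set: I] -> ucp f ->
  (forall x, f (f x) = f x) -> injective_system (range f).
Proof.
move=> [_ injI] uf ff; split.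
  split; first by exists 1 => //; exact: ucp1.
    by move=> c _ _ [x _ <-] [y _ <-]; exists (c *: x + y) => //; exact: (ucp_linear uf).
  by move=> _ [x _ <-]; exists (star x) => //; rewrite ucp_star.
move=> C S T g oS oT ST [gr gl g1 gp].
have [h [_ hl h1 hp] hg] := injI C S T g oS oT ST (And4 (fun _ _ => Logic.I) gl g1 gp).
exists (f \o h).
  split.
  - by move=> x _; exists (h x).
  - by move=> c x y Tx Ty /=; rewrite hl // (ucp_linear uf).
  - by rewrite /= h1 (ucp1 uf).
  - by move=> n X TX pX; rewrite map_mx_comp; apply/(ucp_cp uf)/hp.
by move=> x Sx /=; rewrite hg //; have [y _ <-] := gr _ Sx.
Qed.

(** The range of [s] is an injective system containing [k(A)], hence all of [I]; an idempotent with
    full range is the identity. *)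
Lemma minimal_id s : injective_envelope k -> minimal s -> app s = id.
Proof.
move=> [injI mk] ms; have ff := minimal_idempotent ms.
have rT : range (app s) = setT.
  apply: mk; first exact: idempotent_range_injective.
  by move=> a; exists (k a) => //; exact: app_k.
apply/funext => y; have : range (app s) y by rewrite rT.
by move=> [x _ <-]; rewrite ff.
Qed.

(** Once a minimal map exists, it is the identity. By contractivity [phi] lies below the identity,
    so it is minimal too. *)
Lemma injective_envelope_rigid (phi : I -> I) :
  injective_envelope k -> pseudo_expectation k k phi -> phi = id.
Proof.
move=> kI pphi.
have [m mm] : exists m, minimal m.
  apply: (ZL_preorder pid shrink_refl shrink_trans) => Ch chT.
  have [[s Chs]|nCh] := pselect (exists s, Ch s).
    exact: chain_bound chT s Chs kI.1.
  by exists pid => s Chs; exfalso; apply: nCh; exists s.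
have m_id := minimal_id kI mm.
have to_phi t : shrink m t by apply/asboolP => x sx; rewrite m_id; exact: ucp_nrm_sa.
apply: (@minimal_id (exist _ phi pphi) kI) => t _.
exact: shrink_trans (mm _ (to_phi t)) (to_phi _).
Qed.

End Rigidity.

(** * Full projections *)

Section FullProjection.
Variables (R : realType) (A : cstarAlgType R).
Implicit Types (x y z w : A) (s : seq (A * A)).

(** Neumann series: [u n] is a partial sum of the powers of [x], dominated by the geometric series
    of ratio [r]. *)
Lemma near1_right_inverse w : nrm (1 - w) < 1 -> exists v, w * v = 1.
Proof.
set x := 1 - w => x1.
pose r := nrm x; have r0 : 0 <= r by exact: nrm_ge0.
pose u n := iter n (fun v => 1 + x * v) (0 : A).
pose s n := iter n (fun t : R => 1 + r * t) 0.
have uS n : u n.+1 = 1 + x * u n by [].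
have sS n : s n.+1 = 1 + r * s n by [].
have sM n : s n <= (1 - r)^-1.
  have r1 : 0 < 1 - r by rewrite subr_gt0.
  elim: n => [|n IH]; first by rewrite invr_ge0 ltW.
  rewrite sS; apply: (@le_trans _ _ (1 + r * (1 - r)^-1)).
    by rewrite lerD2l ler_wpM2l.
  by rewrite -{1}(mulfV (lt0r_neq0 r1)) -mulrDl subrK mul1r.
have us n : nrm (u n.+1 - u n) <= s n.+1 - s n.
  elim: n => [|n IH].
    by rewrite /u /s /= mulr0 addr0 subr0 mulr0 addr0 subr0 nrm1.
  have -> : u n.+2 - u n.+1 = x * (u n.+1 - u n) by rewrite !uS; ncring.
  have -> : s n.+2 - s n.+1 = r * (s n.+1 - s n) by rewrite !sS; ring.
  by apply: le_trans (nrmM _ _) _; rewrite ler_wpM2l.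
have [v uv] := dominated_limto sM us.
have vE : v = 1 + x * v.
  apply: (@limto_unique _ _ (fun n => u n.+1)); first exact: limto_shift.
  apply: (@limto_eq _ _ (fun n => 1 + x * u n)) => //.
  by apply: limtoD; [exact: limto_cst | apply: limtoM => //; exact: limto_cst].
exists v; have -> : w * v = v - x * v by rewrite /x; ncring.
by rewrite {1}vE addrK.
Qed.

Variable p : full_projection A.
Local Notation e := (nzproj p).

Let ee : e * e = e := nzprojK p.
Let se : star e = e := nzproj_star p.

Let gen s : A := \sum_(u <- s) u.1 * e * u.2.

Let gen_cat s t : gen (s ++ t) = gen s + gen t.
Proof. by rewrite /gen big_cat. Qed.

(** The norm closure of the algebraic ideal [A p A], as [full] is about closed ideals. *)
Let ideal : set A := [set z | forall d : R, 0 < d -> exists s, nrm (z - gen s) < d].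

Let ideal_closed : closed_ideal ideal.
Proof.
split.
- move=> x xJ d d0.
  have d2 : 0 < d / 2 by rewrite divr_gt0.
  have d2C : 0 < (d / 2)%:C :> R[i] by rewrite ltcR.
  have [y [yJ]] := xJ _ (nbhsx_ballx (x : normed_of A) _ d2C).
  rewrite -ball_normE /= normed_ofE cnormE ltcR => xy.
  have [s ys] := yJ _ d2; exists s.
  have -> : x - gen s = (x - y) + ((y : A) - gen s) by ncring.
  by apply: le_lt_trans (nrmD _ _) _; lra.
- by move=> d d0; exists [::]; rewrite /gen big_nil subr0 nrm0.
- move=> x y xJ yJ d d0.
  have d2 : 0 < d / 2 by rewrite divr_gt0.
  have [[s hs] [t ht]] := (xJ _ d2, yJ _ d2); exists (s ++ t).
  have -> : x + y - gen (s ++ t) = (x - gen s) + (y - gen t) by rewrite gen_cat; ncring.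
  by apply: le_lt_trans (nrmD _ _) _; lra.
- move=> a x xJ.
  have K0 : 0 < nrm a + 1 by rewrite ltr_wpDl ?nrm_ge0.
  split=> d d0; have [s hs] := xJ _ (divr_gt0 d0 K0); rewrite ltr_pdivlMr // in hs.
    exists [seq (a * u.1, u.2) | u <- s].
    have -> : gen [seq (a * u.1, u.2) | u <- s] = a * gen s.
      by rewrite /gen big_map mulr_sumr; apply: eq_bigr => u _; rewrite !mulrA.
    rewrite -mulrBr; apply: le_lt_trans (nrmM _ _) _.
    by have := nrm_ge0 (x - gen s); nra.
  exists [seq (u.1, u.2 * a) | u <- s].
  have -> : gen [seq (u.1, u.2 * a) | u <- s] = gen s * a.
    by rewrite /gen big_map mulr_suml; apply: eq_bigr => u _; rewrite !mulrA.
  rewrite -mulrBl; apply: le_lt_trans (nrmM _ _) _.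
  by have := nrm_ge0 (x - gen s); nra.
Qed.

Let ideal_e : ideal e.
Proof.
move=> d d0; exists [:: (1, 1)].
by rewrite /gen big_seq1 mul1r mulr1 subrr nrm0.
Qed.

(* With 1 = sum x_i e y_i, h = sum y_i^* e y_i and c = sum x_i x_i^*, expanding
   sum |t x_i^* - e y_i|^2 >= 0 gives h >= 2 t - t^2 c, so h is invertible. *)
Lemma full_projection_decomposition :
  exists N (a : 'I_N -> A), \sum_i star (a i) * e * a i = 1.
Proof.
have [s hs] : exists s, gen s = 1.
  (* Some [gen s] is at distance less than 1 from 1; its right inverse [v] is absorbed into the
     right factors. *)
  have /(_ _ ltr01)[s] : ideal 1 by rewrite (@fproj_full _ _ p _ ideal_closed ideal_e).
  move/near1_right_inverse => [v hv]; exists [seq (u.1, u.2 * v) | u <- s].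
  by rewrite -hv /gen big_map mulr_suml; apply: eq_bigr => u _; rewrite !mulrA.
pose x (i : 'I_(size s)) := (tnth (in_tuple s) i).1.
pose y (i : 'I_(size s)) := (tnth (in_tuple s) i).2.
have xy : \sum_i x i * e * y i = 1 by rewrite -hs /gen [RHS]big_tnth.
have [h hE] : exists h, h = \sum_i star (y i) * e * y i by eexists.
have ph : pos h.
  rewrite hE; apply: pos_sum => i _; rewrite -ee -{1}se mulrA -mulrA -starM.
  exact: star_mul_pos.
have [c cE] : exists c, c = \sum_i x i * star (x i) by eexists.
have pc : pos c.
  by rewrite cE; apply: pos_sum => i _; rewrite -{1}(starK (x i)); exact: star_mul_pos.
(* Chosen so that [t^2 c <= t], whence [h >= 2 t - t^2 c >= t]. *)
pose t := (1 + nrm c)^-1.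
have t0 : 0 < t by rewrite invr_gt0 ltr_pwDl ?nrm_ge0.
have ht : pos (h - rsc A t).
  have sq : pos (\sum_i star (t%:C *: star (x i) - e * y i) * (t%:C *: star (x i) - e * y i)).
    by apply: pos_sum => i _; exact: star_mul_pos.
  have sqE : \sum_i star (t%:C *: star (x i) - e * y i) * (t%:C *: star (x i) - e * y i) =
      (t * t)%:C *: c - (rsc A t + rsc A t) + h.
    transitivity (\sum_i ((t * t)%:C *: (x i * star (x i)) -
        (t%:C *: (x i * e * y i) + t%:C *: star (x i * e * y i)) + star (y i) * e * y i)).
      apply: eq_bigr => i _; rewrite starB starZr starK !starM se.
      rewrite mulrBl !mulrBr -!scalerAl -!scalerAr scalerA -rmorphM.
      have -> : star (y i) * e * (e * y i) = star (y i) * e * y i.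
        by rewrite -mulrA (mulrA e) ee mulrA.
      rewrite !mulrA.
      by set u := _ *: _; set v := _ *: (_ * y i); set w := _ *: (_ * star (x i)); ncring.
    rewrite big_split sumrB big_split /= -!scaler_sumr -cE -hE -star_sum xy star1.
    reflexivity.
  have tc : pos (rsc A t - (t * t)%:C *: c).
    apply: sa_nrm_sub; first by rewrite starZr pos_sa.
    rewrite nrmZr ger0_norm; last by rewrite mulr_ge0 ?ltW.
    rewrite -mulrA ger_pMr // mulrC ler_pdivrMr ?ltr_pwDl ?nrm_ge0 // mul1r.
    by rewrite lerDr.
  have := posD sq tc; rewrite sqE; congr (pos _); ncring.
(* From [t <= h <= tau] follows [0 <= 1 - h / tau <= 1 - t / tau < 1], so [h / tau] has a right
   inverse. *)
pose tau := nrm h + 1.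
have tau0 : 0 < tau by rewrite ltr_wpDl ?nrm_ge0.
have ttau : t <= tau.
  have : nrm (rsc A t) <= nrm h by apply: pos_nrm_mono => //; apply/pos_rsc/ltW.
  by rewrite nrm_rsc gtr0_norm // /tau; lra.
have n1 : nrm (1 - (tau^-1)%:C *: h) < 1.
  apply: (@le_lt_trans _ _ (1 - tau^-1 * t)); last first.
    by rewrite gtrBl; apply: mulr_gt0 => //; rewrite invr_gt0.
  apply: pos_nrm_le.
  - by rewrite subr_ge0 mulrC ler_pdivrMr // mul1r.
  - have -> : 1 - (tau^-1)%:C *: h = (tau^-1)%:C *: (rsc A tau - h).
      by rewrite scalerBr -(rscM _ (rsc A tau)) -rsc_mul mulVf ?gt_eqF // rsc1.
    apply: posZ; first by rewrite invr_ge0 ltW.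
    by apply: sa_nrm_sub; [exact: pos_sa | rewrite lerDl].
  - have -> : rsc A (1 - tau^-1 * t) - (1 - (tau^-1)%:C *: h) =
       (tau^-1)%:C *: (h - rsc A t).
      by rewrite rscB rsc1 rsc_mul scalerBr -(rscM _ (rsc A t)); ncring.
    by apply: posZ => //; rewrite invr_ge0 ltW.
have [v hv] := near1_right_inverse n1.
have [g [/pos_sa sg gg _]] := pos_sqrt ph.
(* A right inverse of the root [g] of [h], so that [d^* h d = (g d)^* (g d) = 1]. *)
pose d := g * ((tau^-1)%:C *: v).
have gd : g * d = 1 by rewrite /d mulrA gg -scalerAr scalerAl.
exists (size s), (fun i => y i * d).
have -> : \sum_i star (y i * d) * e * (y i * d) = star d * h * d.
  rewrite hE mulr_sumr mulr_suml; apply: eq_bigr => i _.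
  by rewrite starM !mulrA.
transitivity ((star d * star g) * (g * d)); first by rewrite -gg sg; ncring.
by rewrite -starM gd star1 mul1r.
Qed.

End FullProjection.

(** * Corners *)

Section CornerMaps.
Variables (R : realType) (B : cstarAlgType R) (q : nz_projection B).

Lemma compress_subproof (x : B) :
  nzproj q * (nzproj q * x * nzproj q) * nzproj q == nzproj q * x * nzproj q.
Proof. by rewrite !mulrA nzprojK -mulrA nzprojK. Qed.

Definition compress (x : B) : corner q := Corner (compress_subproof x).

Lemma val_compress x : val (compress x) = nzproj q * x * nzproj q.
Proof. by []. Qed.

Lemma compress_linear : linear compress.
Proof.
move=> c x y; apply: val_inj.
rewrite val_compress mulrDr mulrDl -scalerAr -scalerAl; reflexivity.
Qed.

Lemma val_corner_linear : linear (val : corner q -> B).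
Proof. by []. Qed.

Lemma mx_positive_corner n (X : 'M[corner q]_n) :
  mx_positive (map_mx val X) -> mx_positive X.
Proof. by apply: mx_positive_reflect => //; exact: val_inj. Qed.

Lemma mx_positive_val : completely_positive (val : corner q -> B).
Proof.
move=> n X /mx_positiveE[Y hY].
apply: (@gram_positive _ _ 'I_n _ _ (fun t i => val (Y t i))) => i j.
by rewrite mxE hY (big_morph val (linD val_corner_linear) (lin0 val_corner_linear)).
Qed.

Lemma mx_positive_compress : completely_positive compress.
Proof.
move=> n X /mx_positiveE[Y hY]; apply: mx_positive_corner.
apply: (@gram_positive _ _ 'I_n _ _ (fun t i => Y t i * nzproj q)) => i j.
rewrite !mxE val_compress hY mulr_sumr mulr_suml; apply: eq_bigr => t _.
by rewrite starM nzproj_star !mulrA.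
Qed.

End CornerMaps.

Section Conjugation.
Variable R : realType.
Implicit Types C D : cstarAlgType R.

Lemma mx_positive_conj C (b : C) n (X : 'M[C]_n) :
  mx_positive X -> mx_positive (map_mx (fun x => star b * x * b) X).
Proof.
move=> /mx_positiveE[Y hY].
apply: (@gram_positive _ _ 'I_n _ _ (fun t i => Y t i * b)) => i j.
rewrite mxE hY mulr_sumr mulr_suml; apply: eq_bigr => t _.
by rewrite starM !mulrA.
Qed.

Lemma mx_positiveD C n (X Y : 'M[C]_n) :
  mx_positive X -> mx_positive Y -> mx_positive (X + Y).
Proof.
move=> pX pY; have -> : X + Y = \sum_(b : bool) (if b then X else Y) by rewrite big_bool.
by apply: mx_positive_sum => -[].
Qed.

End Conjugation.

(** * Restriction to the corner and extension from it *)

Section CornerCorrespondence.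
Variables (R : realType) (A B I : cstarAlgType R).
Variables (f : cstar_inclusion A B) (k : cstar_inclusion A I) (p : nz_projection A).

Local Notation e := (nzproj p).
Local Notation fp := (corner_inclusion f p).
Local Notation kp := (corner_inclusion k p).
Local Notation fq := (map_projection f p).
Local Notation kq := (map_projection k p).

(** [compress] gives a value in the corner for every [Psi]; on a pseudo-expectation it changes
    nothing, by the bimodule property. *)
Definition corner_restrict (Psi : B -> I) (x : corner fq) : corner kq :=
  compress kq (Psi (val x)).

Lemma corner_restrict_pseudo Psi :
  pseudo_expectation f k Psi -> pseudo_expectation fp kp (corner_restrict Psi).
Proof.
move=> [uP Pf]; split.
  apply/ucpP; split.
  - move=> c x y; rewrite /corner_restrict -compress_linear.
    by congr (compress _ _); exact: (ucp_linear uP).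
  - apply: val_inj; transitivity (k e * k e * k e).
      by rewrite -[X in _ = _ * X * _]Pf.
    by rewrite -!rmorphM !nzprojK.
  - move=> n X pX.
    have -> : map_mx (corner_restrict Psi) X =
        map_mx (compress kq) (map_mx Psi (map_mx val X)).
      by apply/matrixP => i j; rewrite !mxE.
    by apply/mx_positive_compress/(ucp_cp uP)/mx_positive_val.
move=> a; apply: val_inj; rewrite /corner_restrict val_compress /= Pf.
by rewrite -!rmorphM cornerE.
Qed.

Variables (N : nat) (a : 'I_N -> A).
Hypothesis ha : \sum_i star (a i) * e * a i = 1.

Definition corner_extend (Phi : corner fq -> corner kq) (b : B) : I :=
  \sum_i \sum_j star (k (a i)) *
    val (Phi (compress fq (f (a i) * b * star (f (a j))))) * k (a j).

Lemma corner_extend_pseudo Phi :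
  pseudo_expectation fp kp Phi -> pseudo_expectation f k (corner_extend Phi).
Proof.
move=> [uP Pf]; have Pl := ucp_linear uP.
have ext_f x : corner_extend Phi (f x) = k x.
  transitivity (k (\sum_i \sum_j (star (a i) * e * a i) * x * star (star (a j) * e * a j))).
    rewrite rmorph_sum; apply: eq_bigr => i _; rewrite rmorph_sum; apply: eq_bigr => j _.
    have -> : compress fq (f (a i) * f x * star (f (a j))) =
        fp (compress p (a i * x * star (a j))).
      by apply: val_inj; rewrite /= -cincl_star -!rmorphM.
    rewrite Pf /= -cincl_star -!rmorphM; congr (k _).
    by rewrite !starM starK nzproj_star !mulrA.
  congr (k _); transitivity ((\sum_i star (a i) * e * a i) * x *
      star (\sum_j star (a j) * e * a j)); last by rewrite ha star1 mulr1 mul1r.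
  rewrite !mulr_suml; apply: eq_bigr => i _.
  by rewrite star_sum mulr_sumr.
split=> //; apply/ucpP; split.
- move=> c x y; rewrite /corner_extend scaler_sumr -big_split; apply: eq_bigr => i _.
  rewrite scaler_sumr -big_split; apply: eq_bigr => j _ /=.
  rewrite mulrDr mulrDl -scalerAr -scalerAl compress_linear Pl /=.
  by rewrite mulrDr mulrDl -scalerAr -scalerAl.
- by rewrite -(rmorph1 f) ext_f rmorph1.
- move=> n X /mx_positiveE[Y hY].
  (* Pairs (row of [X], index of [a]) are flattened to ordinals. [Z] is the matrix [V X V^*] over
     the corner of [B], and a Gram factor of its image under [Phi], multiplied by the [k (a i)], is
     one for the image of [X]. *)
  pose T := ('I_n * 'I_N)%type; pose m := #|{: T}|.
  pose Z : 'M[corner fq]_m := \matrix_(u, v)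
    compress fq (f (a (enum_val u).2) * X (enum_val u).1 (enum_val v).1 * star (f (a (enum_val v).2))).
  have pZ : mx_positive Z.
    apply: mx_positive_corner.
    apply: (@gram_positive _ _ 'I_n _ _
      (fun t u => Y t (enum_val u).1 * star (f (a (enum_val u).2)) * nzproj fq)) => u v.
    rewrite !mxE val_compress hY mulr_sumr mulr_suml mulr_sumr mulr_suml.
    apply: eq_bigr => t _.
    by rewrite !starM nzproj_star starK !mulrA.
  have [V hV] := mx_positiveE (ucp_cp uP pZ).
  apply: (@gram_positive _ _ 'I_m _ _
    (fun t r => \sum_i val (V t (enum_rank (r, i))) * k (a i))) => r s.
  rewrite mxE /corner_extend.
  transitivity (\sum_i \sum_j \sum_t star (val (V t (enum_rank (r, i))) * k (a i)) *
      (val (V t (enum_rank (s, j))) * k (a j))).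
    apply: eq_bigr => i _; apply: eq_bigr => j _.
    have := hV (enum_rank (r, i)) (enum_rank (s, j)).
    rewrite !mxE !enum_rankK /= => ->.
    rewrite (big_morph val (linD (@val_corner_linear _ _ kq)) (lin0 (@val_corner_linear _ _ kq))).
    rewrite mulr_sumr mulr_suml; apply: eq_bigr => t _.
    by rewrite starM !mulrA.
  transitivity (\sum_t \sum_i \sum_j star (val (V t (enum_rank (r, i))) * k (a i)) *
      (val (V t (enum_rank (s, j))) * k (a j))).
    rewrite [RHS]exchange_big; apply: eq_bigr => i _.
    by rewrite exchange_big.
  apply: eq_bigr => t _; rewrite star_sum mulr_suml; apply: eq_bigr => i _.
  by rewrite mulr_sumr.
Qed.

(** The bimodule property moves the outer [a_i^*] and [a_j] inside [Psi], where the sums on both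
    sides of [b] become 1. *)
Lemma corner_restrictK Psi : pseudo_expectation f k Psi ->
  corner_extend (corner_restrict Psi) = Psi.
Proof.
move=> pP; apply/funext => b.
transitivity (Psi ((\sum_i f (star (a i) * e * a i)) * b * (\sum_j f (star (a j) * e * a j)))).
  rewrite /corner_extend !mulr_suml (lin_sum _ _ _ (ucp_linear pP.1)).
  apply: eq_bigr => i _; rewrite mulr_sumr (lin_sum _ _ _ (ucp_linear pP.1)).
  apply: eq_bigr => j _.
  rewrite (pseudo_expectation_mulr pP) (pseudo_expectation_mull pP).
  rewrite /corner_restrict !val_compress /=.
  have -> : f e * (f (a i) * b * star (f (a j))) * f e = f (e * a i) * b * f (star (a j) * e).
    by rewrite -cincl_star !rmorphM !mulrA.
  rewrite (pseudo_expectation_mulr pP) (pseudo_expectation_mull pP) -cincl_star.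
  rewrite !mulrA -!rmorphM -!mulrA -!rmorphM.
  by rewrite !mulrA -[star (a i) * e * e]mulrA -[star (a j) * e * e]mulrA nzprojK.
by rewrite -rmorph_sum ha rmorph1 mul1r mulr1.
Qed.

(** Since [x = p x p], the argument of [Phi] is [(p a_i p) x (p a_j^* p)], and [Phi] is a bimodule
    map over pAp; the sums left outside are [p]. *)
Lemma corner_extendK Phi : pseudo_expectation fp kp Phi ->
  corner_restrict (corner_extend Phi) = Phi.
Proof.
move=> pP; apply/funext => x; apply: val_inj; rewrite val_compress /=.
transitivity ((\sum_i k (e * star (a i) * e * a i * e)) * val (Phi x) *
    (\sum_j k (e * star (a j) * e * a j * e))).
  rewrite /corner_extend mulr_sumr mulr_suml !mulr_suml.
  apply: eq_bigr => i _; rewrite mulr_sumr mulr_suml mulr_sumr.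
  apply: eq_bigr => j _.
  have -> : compress fq (f (a i) * val x * star (f (a j))) =
      fp (compress p (a i)) * x * fp (compress p (star (a j))).
    apply: val_inj; rewrite /= -{1}(cornerE x) /= -cincl_star !rmorphM !mulrA.
    by rewrite -!mulrA.
  rewrite (pseudo_expectation_mulr pP) (pseudo_expectation_mull pP) /=.
  by rewrite -!cincl_star !rmorphM !mulrA.
have s1 : \sum_i e * star (a i) * e * a i * e = e.
  transitivity (e * (\sum_i star (a i) * e * a i) * e).
    by rewrite mulr_sumr mulr_suml; apply: eq_bigr => i _; rewrite !mulrA.
  by rewrite ha mulr1 nzprojK.
by rewrite -rmorph_sum s1; exact: (cornerE (Phi x)).
Qed.

End CornerCorrespondence.

(** * The injective envelope of the corner *)

Section CornerEnvelope.
Variables (R : realType) (A I J : cstarAlgType R) (p : full_projection A).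
Variables (k : cstar_inclusion A I) (l : cstar_inclusion (corner p) J).

Local Notation e := (nzproj p).
Local Notation kq := (map_projection k p).
Local Notation kp := (corner_inclusion k p).

(* With q = k(p) and c_i = k(a_i) (1 - q), the map x |-> x + sum_i c_i^* x c_i is ucp
   from the corner to I, and compressing it by q gives back x; extending it to J and
   compressing shows that the corner of I is injective relative to l. *)
Lemma extension_to_corner : injective_system [set: I] ->
  exists2 theta : J -> corner kq, ucp theta & forall x, theta (l x) = kp x.
Proof.
move=> injI; have [N [a ha]] := full_projection_decomposition p.
have ee : e * e = e := nzprojK p.
pose q := k e; pose c i := k (a i) * (1 - q).
have qq : q * q = q by rewrite -rmorphM ee.
have sq : star q = q by rewrite -cincl_star (nzproj_star p).
pose g (x : corner p) : I := k (val x) + \sum_i star (c i) * k (val x) * c i.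
have ug : ucp g.
  apply/ucpP; split.
  - move=> z x y; rewrite /g.
    have kl : k (val (z *: x + y)) = z *: k (val x) + k (val y) by rewrite -linearP.
    rewrite kl scalerDr scaler_sumr addrACA -big_split; congr (_ + _).
    by apply: eq_bigr => i _; rewrite mulrDr mulrDl -scalerAr -scalerAl.
  - have -> : g 1 = q + \sum_i star (c i) * q * c i by [].
    have -> : \sum_i star (c i) * q * c i =
        (1 - q) * k (\sum_i star (a i) * e * a i) * (1 - q).
      rewrite rmorph_sum mulr_sumr mulr_suml; apply: eq_bigr => i _.
      by rewrite /c starM starB star1 sq !rmorphM -cincl_star !mulrA.
    rewrite ha rmorph1 mulr1 mulrBl mul1r mulrBr mulr1 qq subrr subr0.
    by rewrite addrC subrK.
  - move=> n X pX.
    have pk : mx_positive (map_mx (fun x : corner p => k (val x)) X).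
      have -> : map_mx (fun x : corner p => k (val x)) X = map_mx k (map_mx val X).
        by apply/matrixP => i j; rewrite !mxE.
      exact/(ucp_cp (ucp_cincl k))/mx_positive_val.
    have -> : map_mx g X = map_mx (fun x : corner p => k (val x)) X + \sum_i
        map_mx (fun y => star (c i) * y * c i) (map_mx (fun x : corner p => k (val x)) X).
      apply/matrixP => i j; rewrite !mxE summxE; congr (_ + _).
      by apply: eq_bigr => t _; rewrite !mxE.
    apply: mx_positiveD => //; apply: mx_positive_sum => i.
    exact: mx_positive_conj.
have [h uh hl] := injective_extension l injI ug.
exists (compress kq \o h).
  apply/ucpP; split.
  - by move=> z x y /=; rewrite (ucp_linear uh) compress_linear.
  - by apply: val_inj; rewrite val_compress (ucp1 uh) mulr1 nzprojK.
  - move=> n X pX; rewrite map_mx_comp.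
    by apply/mx_positive_compress/(ucp_cp uh).
move=> x; apply: val_inj; rewrite val_compress hl /= -/q /g mulrDr mulrDl.
have -> : q * (\sum_i star (c i) * k (val x) * c i) * q = 0.
  have qc i : q * star (c i) = 0.
    by rewrite starM starB star1 sq mulrA mulrBr mulr1 qq subrr mul0r.
  by rewrite mulr_sumr mulr_suml big1 // => i _; rewrite !mulrA qc !mul0r.
by rewrite addr0 /q -!rmorphM (cornerE x).
Qed.

Lemma corner_envelope_iso : injective_envelope k -> injective_envelope l ->
  exists (theta : corner kq -> J) (theta' : J -> corner kq),
    [/\ ucp theta /\ (forall x, theta (kp x) = l x),
        ucp theta' /\ (forall x, theta' (l x) = kp x),
        cancel theta theta' & cancel theta' theta].
Proof.
move=> kE lE; have [N [a ha]] := full_projection_decomposition p.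
have [theta u1 h1] := injective_extension kp lE.1 (ucp_cincl l).
have [theta' u2 h2] := extension_to_corner kE.1.
exists theta, theta'; split => //.
  (* For [B = I] the extension of [Phi] is the identity by rigidity, so [Phi] is the restriction of
     the identity; both [id] and [theta' \o theta] are such maps. *)
  have kp_unique Phi : pseudo_expectation kp kp Phi -> Phi = corner_restrict k id.
    move=> pP; rewrite -(corner_extendK (a := a) ha pP).
    by rewrite (injective_envelope_rigid kE (corner_extend_pseudo ha pP)).
  have t1 : pseudo_expectation kp kp (theta' \o theta).
    by split; [exact: ucp_comp | move=> x /=; rewrite h1 h2].
  have t2 : pseudo_expectation kp kp id by split; [exact: ucp_id |].
  move=> x; rewrite -[LHS]/((theta' \o theta) x).
  by rewrite (kp_unique _ t1) -(kp_unique _ t2).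
have t3 : pseudo_expectation l l (theta \o theta').
  by split; [exact: ucp_comp | move=> x /=; rewrite h2 h1].
by move=> x; rewrite -[LHS]/((theta \o theta') x) (injective_envelope_rigid lE t3).
Qed.

End CornerEnvelope.

(** * Transport to an arbitrary injective envelope of the corner *)

Lemma comp_cancel (X Y Z : Type) (f : Y -> Z) (g : Z -> Y) (h : X -> Y) :
  cancel f g -> g \o (f \o h) = h.
Proof. by move=> fK; apply/funext => x /=; rewrite fK. Qed.

Lemma bijective_sig_unique (S T : Type) (P : S -> Prop) (Q : T -> Prop)
    (F : {x | P x} -> {y | Q y}) :
  bijective F -> ((exists! y, Q y) <-> (exists! x, P x)).
Proof.
move=> [G FK GK]; split=> [[y [Qy uy]]|[x [Px ux]]].
  exists (sval (G (exist _ y Qy))); split; first exact: (svalP (G _)).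
  move=> x Px; rewrite -[x]/(sval (exist P x Px)) -(FK (exist P x Px)).
  congr (sval (G _)); case: (F _) => z Qz.
  by apply: eq_exist; exact: uy.
exists (sval (F (exist _ x Px))); split; first exact: (svalP (F _)).
move=> y Qy; rewrite -[y]/(sval (exist Q y Qy)) -(GK (exist Q y Qy)).
congr (sval (F _)); case: (G _) => z Pz.
by apply: eq_exist; exact: ux.
Qed.

Theorem theorem2p11 (R : realType) (A B : cstarAlgType R)
    (iota : cstar_inclusion A B) (p : full_projection A)
    (I : cstarAlgType R) (kappa : cstar_inclusion A I)
    (J : cstarAlgType R) (lambda : cstar_inclusion (corner p) J) :
  injective_envelope kappa ->
  injective_envelope lambda ->
  (exists F : {Psi : B -> I | pseudo_expectation iota kappa Psi} ->
              {Phi : corner (map_projection iota p) -> J |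
                 pseudo_expectation (corner_inclusion iota p) lambda Phi},
     bijective F) /\
  ((exists! Phi : corner (map_projection iota p) -> J,
      pseudo_expectation (corner_inclusion iota p) lambda Phi) <->
   (exists! Psi : B -> I, pseudo_expectation iota kappa Psi)).
Proof.
move=> kE lE.
suff hF : exists F : {Psi : B -> I | pseudo_expectation iota kappa Psi} ->
              {Phi : corner (map_projection iota p) -> J |
                 pseudo_expectation (corner_inclusion iota p) lambda Phi},
     bijective F.
  by split=> //; have [F bF] := hF; exact: bijective_sig_unique bF.
have [N [a ha]] := full_projection_decomposition p.
have [theta [theta' [[u1 h1] [u2 h2] K1 K2]]] := corner_envelope_iso kE lE.
(* [theta] and [theta'] are ucp and compatible with the two inclusions of pAp, so composing with
   them exchanges pseudo-expectations valued in the corner of [I] and in [J]. *)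
have fwd Psi : pseudo_expectation iota kappa Psi ->
    pseudo_expectation (corner_inclusion iota p) lambda (theta \o corner_restrict kappa Psi).
  move=> /corner_restrict_pseudo -/(_ p)[uP Pf].
  by split; [exact: ucp_comp | move=> x /=; rewrite -h1 -Pf].
have bwd' Phi : pseudo_expectation (corner_inclusion iota p) lambda Phi ->
    pseudo_expectation (corner_inclusion iota p) (corner_inclusion kappa p) (theta' \o Phi).
  move=> [uP Pf].
  by split; [exact: ucp_comp | move=> x /=; rewrite Pf h2].
have bwd Phi (pP : pseudo_expectation (corner_inclusion iota p) lambda Phi) :=
  corner_extend_pseudo ha (bwd' Phi pP).
exists (fun Psi => exist _ _ (fwd _ (svalP Psi))).
exists (fun Phi => exist _ _ (bwd _ (svalP Phi))).
  move=> [Psi pP]; apply: eq_exist => /=.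
  by rewrite (comp_cancel _ K1); exact: corner_restrictK.
move=> [Phi pP]; apply: eq_exist => /=.
by rewrite (corner_extendK ha (bwd' _ pP)); exact: comp_cancel.
Qed.
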